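(* Assuming that the continuum $\mathfrak{c}$ is a real-valued measurable cardinal, there exists a Banach space whose norm satisfies (S) but which does not admit any strictly convex equivalent norm. Moreover, for any real Banach space $X$ we have: (i) if $\dim X\leqslant 2$, then $X$ has property (S) if and only if $X$ is strictly convex; (ii) if $\dim X>2$ and $X$ admits a renorming with property (S), then it also admits a non-strictly convex renorming with property (S).
   Context: All Banach spaces are real. A subset $A$ of a metric space $X$ is called quasi-finite if $A$ is infinite and every ball in $X$ contains only finitely many elements of $A$. A metric space (in particular a Banach space with the metric given by its norm) $X$ has Steinhaus' property (S) if for any quasi-finite set $A\subset X$ there exists a dense set $Y\subset X$ such that for all $y\in Y$ and all $n\in\mathbb{N}$ (positive integers) there exists a ball $B$ (open ball) centred at $y$ with $|A\cap B|=n$. A norm (or the normed space) is strictly convex if its unit sphere contains no line segment with two distinct endpoints. A renorming of a Banach space $X$ is an equivalent norm on $X$; (ii) means that if some equivalent norm on $X$ has property (S), then some equivalent norm on $X$ is not strictly convex and has property (S). An uncountable cardinal $\kappa$ is real-valued measurable if there is a $\kappa$-complete probability measure, defined on all subsets of a set of cardinality $\kappa$, vanishing on singletons. Here a measure $\mu$ is $\lambda$-complete ($\lambda$ an uncountable cardinal) if for every cardinal $\kappa'<\lambda$ and every family $(A_\alpha)_{\alpha<\kappa'}$ of measurable sets, the union $A=\bigcup_{\alpha<\kappa'}A_\alpha$ is measurable and $\mu(A)=\sup\{\mu(\bigcup_{\alpha\in F}A_\alpha)\colon F\subset\kappa' \text{ finite}\}$. For $\kappa=\mathfrak{c}$ this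 amounts to the existence of an atomless $\mathfrak{c}$-complete probability measure on the power set of a set of cardinality $\mathfrak{c}$. *)

(* Defs.v *)
From HB Require Import structures.
From mathcomp Require Import all_boot all_order all_algebra.
From mathcomp Require Import all_classical all_reals all_analysis.

Set Implicit Arguments.
Unset Strict Implicit.
Unset Printing Implicit Defensive.

Import Order.TTheory GRing.Theory Num.Theory.
Import numFieldNormedType.Exports.

Local Open Scope classical_set_scope.
Local Open Scope card_scope.
Local Open Scope ring_scope.

Section steinhaus.
Context {R : realType}.

Definition quasi_finite {M : pseudoMetricType R} (A : set M) : Prop :=
  infinite_set A /\
  forall (x : M) (r : R), 0 < r -> finite_set (A `&` ball x r).

(* `I_n is the set of the n numbers below n: its use below says that the
   intersection has exactly n elements. *)
Definition property_S (M : pseudoMetricType R) : Prop :=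
  forall A : set M, quasi_finite A ->
    exists2 Y : set M, dense Y &
      forall y : M, Y y -> forall n : nat, (0 < n)%N ->
        exists2 r : R, 0 < r & A `&` ball y r #= `I_n.

Definition unit_sphere (X : normedModType R) : set X := [set x | `|x| = 1].
Arguments unit_sphere X : clear implicits.

Definition line_segment {X : normedModType R} (x y : X) : set X :=
  [set (1 - t) *: x + t *: y | t in `[0, 1]].

Definition strictly_convex (X : normedModType R) : Prop :=
  forall x y : X, x <> y -> ~ (line_segment x y `<=` unit_sphere X).

Record equivalent_norm (X : normedModType R) := EquivalentNorm {
  eqv_norm : X -> R ;
  eqv_normD : forall x y : X, eqv_norm (x + y) <= eqv_norm x + eqv_norm y ;
  eqv_normZ : forall (a : R) (x : X), eqv_norm (a *: x) = `|a| * eqv_norm x ;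
  eqv_norm_eq0 : forall x : X, eqv_norm x = 0 -> x = 0 ;
  eqv_norm_equiv : exists m M : R, [/\ 0 < m, 0 < M &
    forall x : X, m * `|x| <= eqv_norm x <= M * `|x|] }.

(* An alias of the vector space X which carries the norm N, and the balls and
   topology of N, instead of those of X. *)
Definition renormed (X : normedModType R) (N : equivalent_norm X) : Type := X.

Definition has_dim (V : lmodType R) (n : nat) : Prop :=
  exists e : 'I_n -> V,
    forall x : V, exists! c : 'rV[R]_n, x = \sum_(i < n) c 0 i *: e i.

Definition dim_le (V : lmodType R) (n : nat) : Prop :=
  exists2 m : nat, (m <= n)%N & has_dim V m.

End steinhaus.

HB.instance Definition _ (R : realType) (X : normedModType R)
  (N : equivalent_norm X) := GRing.Lmodule.copy (renormed N) X.

HB.instance Definition _ (R : realType) (X : normedModType R)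
  (N : equivalent_norm X) := @Lmodule_isNormed.Build R (renormed N)
    (@eqv_norm _ _ N) (@eqv_normD _ _ N) (@eqv_normZ _ _ N)
    (@eqv_norm_eq0 _ _ N).

Section real_valued_measurable.
Context {R : realType}.
Local Open Scope ereal_scope.

(* Cardinals are represented by sets: K stands for the cardinal lambda, the
   index set D for a cardinal below it. *)
Definition card_complete {U : Type} (K : set U) {d : measure_display}
    {T : measurableType d} (mu : set T -> \bar R) : Prop :=
  forall (I : Type) (D : set I) (A : I -> set T),
    D #<= K -> D #!= K -> (forall i, D i -> measurable (A i)) ->
    measurable (\bigcup_(i in D) A i) /\
    mu (\bigcup_(i in D) A i) =
      ereal_sup [set mu (\bigcup_(i in F) A i)
                | F in [set F : set I | finite_set F /\ F `<=` D]].

Definition real_valued_measurable {U : Type} (K : set U) : Prop :=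
  ~ countable K /\
  exists (d : measure_display) (T : measurableType d) (mu : probability T R),
    [/\ [set: T] #= K,
        forall A : set T, measurable A,
        card_complete K mu &
        forall x : T, mu [set x] = 0].

End real_valued_measurable.

(* Main.v *)
Require Import Defs.
From HB Require Import structures.
From mathcomp Require Import all_boot all_order all_algebra.
From mathcomp Require Import all_classical all_reals all_analysis.
From mathcomp Require Import ring lra.

(** Say that a norm is aperiodic if, for d <> 0, the equality |x + d| = |x| never
    holds on a whole ball.  Everything rests on [property_SP]: a complete norm
    has property (S) if and only if it is aperiodic.

    If the norm is aperiodic, then for a <> b the closed set of points
    equidistant from a and b has empty interior; a quasi-finite set A is
    countable, so by Baire's theorem a dense set of centres y sees the points of
    A at pairwise distinct distances.  Growing a ball around such a y then
    captures the points of A one at a time.  Conversely, if |x + d| = |x| on a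
    ball U, the points 0 and - d together with a sequence going to infinity form
    a quasi-finite set for which no ball centred in U has exactly one point.

    Homogeneity strengthens periodicity considerably ([periodic_additive]): if
    |x + d| = |x| for all x in a ball, comparing x with (1 + s) x gives
    |x + (x + d)| = |x| + |x + d| there.  Hence strictly convex norms are
    aperiodic, and if the norm is a sum of seminorms, each of them is additive
    on the pair x, x + d.

    In dimension two, a norm which is not strictly convex is linear on the cone
    spanned by two independent vectors p and q; this cone is open, and there the
    norm does not change in the direction |q| p - |p| q.  So it is not
    aperiodic.

    In dimension at least three, a strictly convex norm is replaced by
    n(x) = min_t (|x - t e| + |t| / 2) with |e| = 1, whose unit ball is the
    convex hull of the old ball and of the points 2 e and - 2 e.  Segments issued
    from these tips lie on the new sphere.  On the other hand, if the new norm is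
    additive on the pair x, x + d with d <> 0, the strict convexity of the old one
    forces x into the span of d and e, which contains no ball in dimension at
    least three ([spike_aperiodic]).

    The counterexample is the sum of c_0(R) and l_oo(R), realised as the bounded
    functions z on R + R which vanish at infinity on the left copy of R.  It is
    renormed by adding to the supremum norm a convergent weighted series of the
    seminorms
      p(z) = sup_(|g - q| < k) euclid (z (inl g)) (k * z (inr g))
    over rational q and k = 1 / (n + 1).  For d <> 0, choose g0 where d does not
    vanish.  Near any point there is a z whose left half is supported by finitely
    many points, including g0.  A short window around g0 avoids the others, and
    when k is small the supremum p(z + t d) is attained at g0 alone for all
    small t; since the Euclidean plane is strictly convex, p is not additive on
    the pair z, z + t d once z and d are not parallel at g0
    ([window_family_not_additive]).  So this norm is aperiodic.

    Finally, by an argument of Day, l_oo of an uncountable set has no strictly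
    convex equivalent norm M ([not_strictly_convex_renorming]): successively
    extending a countably supported element of the unit ball so as to
    almost maximise M leads to an element f with M(h) = M(f) for every
    countably supported extension h of f in the ball, and modifying f by +1 and
    -1 at a point outside its support gives a segment on a sphere of M. *)

Set Implicit Arguments.
Unset Strict Implicit.
Unset Printing Implicit Defensive.

Import Order.TTheory GRing.Theory Num.Theory.
Import numFieldNormedType.Exports.

Local Open Scope classical_set_scope.
Local Open Scope ring_scope.

(** * Seminorms, strict convexity and aperiodic norms *)

Definition is_seminorm (R : realType) (V : lmodType R) (n : V -> R) : Prop :=
  (forall x y, n (x + y) <= n x + n y) /\
  (forall a x, n (a *: x) = `|a| * n x).

Section seminorm.
Context {R : realType} {V : lmodType R} {n : V -> R}.
Hypothesis hn : is_seminorm n.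

Lemma seminorm0 : n 0 = 0.
Proof. by rewrite -(scale0r 0) hn.2 normr0 mul0r. Qed.

Lemma seminormN x : n (- x) = n x.
Proof. by rewrite -scaleN1r hn.2 normrN1 mul1r. Qed.

Lemma seminormB x y : n (x - y) <= n x + n y.
Proof. by rewrite -(seminormN y); exact: hn.1. Qed.

Lemma seminorm_ge0 x : 0 <= n x.
Proof. have := seminormB x x; rewrite subrr seminorm0; lra. Qed.

(** Writing a (p + q) as (a p + b q) + (a - b) q and using the triangle inequality
    bounds n (a p + b q) from below. *)
Lemma additive_cone_le p q a b : n (p + q) = n p + n q ->
  0 <= b -> b <= a -> n (a *: p + b *: q) = a * n p + b * n q.
Proof.
move=> pq b0 ba; have a0 : 0 <= a by lra.
apply/eqP; rewrite eq_le; apply/andP; split.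
  by rewrite (le_trans (hn.1 _ _))// !hn.2 !ger0_norm.
have := seminormB (a *: p + b *: q) (- ((a - b) *: q)).
rewrite seminormN opprK -addrA -scalerDl subrKC -scalerDr !hn.2 pq.
by rewrite !ger0_norm ?subr_ge0//; lra.
Qed.

Lemma additive_cone p q a b : n (p + q) = n p + n q ->
  0 <= a -> 0 <= b -> n (a *: p + b *: q) = a * n p + b * n q.
Proof.
move=> pq a0 b0; have [ba|/ltW ab] := leP b a; first exact: additive_cone_le.
by rewrite addrC [RHS]addrC; apply: additive_cone_le => //; rewrite addrC pq addrC.
Qed.

End seminorm.

Section normed.
Context {R : realType}.
Implicit Type X : normedModType R.

Lemma norm_is_seminorm X : is_seminorm (fun x : X => `|x|).
Proof. by split=> *; [exact: ler_normD|exact: normrZ]. Qed.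

Lemma strictly_convexP X : strictly_convex X <->
  forall p q : X, `|p + q| = `|p| + `|q| -> `|q| *: p = `|p| *: q.
Proof.
split=> [sc p q pq|h x y xy seg].
  have [->|p0] := eqVneq p 0; first by rewrite normr0 scaler0 scale0r.
  have [->|q0] := eqVneq q 0; first by rewrite normr0 scaler0 scale0r.
  have np0 : `|p| != 0 by rewrite normr_eq0.
  have nq0 : `|q| != 0 by rewrite normr_eq0.
  apply: contrapT => pq'; apply: (sc (`|p|^-1 *: p) (`|q|^-1 *: q)).
    move=> e; apply: pq'.
    have := congr1 (fun z => (`|p| * `|q|) *: z) e.
    by rewrite !scalerA mulrAC mulfV// mul1r mulfK.
  move=> _ [t /itvP t01 <-]; rewrite /unit_sphere /= !scalerA.
  rewrite (additive_cone (norm_is_seminorm X))//; last 2 first.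
  - by rewrite mulr_ge0 ?invr_ge0// subr_ge0 t01.
  - by rewrite mulr_ge0 ?invr_ge0// t01.
  by rewrite !mulfVK ?subrK.
have sphere t : t \in `[0, 1] -> `|(1 - t) *: x + t *: y| = 1.
  by move=> t01; apply: seg; exists t.
have x1 : `|x| = 1.
  by have := sphere 0; rewrite bound_itvE ler01 subr0 scale1r scale0r addr0; apply.
have y1 : `|y| = 1.
  by have := sphere 1; rewrite bound_itvE ler01 subrr scale1r scale0r add0r; apply.
apply: xy; have := h x y; rewrite x1 y1 !scale1r; apply.
have := sphere 2^-1; rewrite in_itv /=.
have -> : 1 - 2^-1 = 2^-1 :> R by lra.
rewrite -scalerDr normrZ ger0_norm ?invr_ge0//= => /(_ _) H.
have : 2^-1 * `|x + y| = 1 by apply: H; apply/andP; split; lra.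
lra.
Qed.

(** Equivalently, for a <> b the points equidistant from a and b have empty
    interior: translate by b and put d = b - a. *)
Definition aperiodic X : Prop :=
  forall d : X, d != 0 -> forall (x0 : X) (e : R), 0 < e ->
    exists2 x : X, `|x - x0| < e & `|x + d| != `|x|.

(** For small s > 0 the point (1 + s) x is still in the ball, so that
    |x + d + s x| = (1 + s) |x|, while x + d + s x is the convex combination
    s (x + (x + d)) + (1 - s) (x + d). *)
Lemma periodic_additive X (d x0 : X) (e : R) :
  (forall x, `|x - x0| < e -> `|x + d| = `|x|) ->
  forall x, `|x - x0| < e -> `|x + (x + d)| = `|x| + `|x + d|.
Proof.
move=> per x xe; rewrite (per x)//.
(* The first bound makes the combination convex, the second keeps (1 + s) x in the ball. *)
pose s := Num.min 1 ((e - `|x - x0|) / (2 * (`|x| + 1))).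
have x1 : 0 < 2 * (`|x| + 1) by have := normr_ge0 x; lra.
have s0 : 0 < s by rewrite lt_min ltr01 /= divr_gt0// subr_gt0.
have s1 : s <= 1 by rewrite ge_min lexx.
have sx : s * `|x| < e - `|x - x0|.
  have : s * (2 * (`|x| + 1)) <= e - `|x - x0|.
    by rewrite -ler_pdivlMr// ge_min lexx orbT.
  have := normr_ge0 x; nra.
have : `|x + s *: x + d| = (1 + s) * `|x|.
  rewrite per.
    have -> : x + s *: x = (1 + s) *: x by rewrite scalerDl scale1r.
    by rewrite normrZ ger0_norm//; lra.
  rewrite addrAC (le_lt_trans (ler_normD _ _))// normrZ gtr0_norm//.
  by rewrite -ltrBrDl.
have -> : x + s *: x + d = s *: (x + (x + d)) + (1 - s) *: (x + d).
  by rewrite [in RHS]scalerDr -[RHS]addrA -scalerDl subrKC scale1r addrAC addrC.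
move=> E; have := ler_normD (s *: (x + (x + d))) ((1 - s) *: (x + d)).
rewrite {}E !normrZ per// (gtr0_norm s0) ger0_norm ?subr_ge0// => h.
apply/eqP; rewrite eq_le; apply/andP; split.
  by rewrite -{2}(per x xe) ler_normD.
rewrite -(ler_pM2l s0); lra.
Qed.

Lemma strictly_convex_aperiodic X : strictly_convex X -> aperiodic X.
Proof.
move=> /strictly_convexP sc d d0 x0 e e0; apply: contrapT => H.
have per x : `|x - x0| < e -> `|x + d| = `|x|.
  by move=> xe; apply: contrapT => /eqP ne; apply: H; exists x.
have x0e : `|x0 - x0| < e by rewrite subrr normr0.
have [x00|x00] := eqVneq x0 0.
  have := per _ x0e; rewrite x00 add0r normr0 => /eqP; rewrite normr_eq0.
  by rewrite (negbTE d0).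
have := sc _ _ (periodic_additive per x0e); rewrite per//.
move/(scalerI (_ : `|x0| != 0)); rewrite normr_eq0 => /(_ x00) /eqP.
by rewrite -subr_eq0 opprD addrA subrr sub0r oppr_eq0 (negbTE d0).
Qed.

End normed.

(** * Property (S) is aperiodicity of the norm *)

Section property_S_characterization.
Context {R : realType}.

Lemma ball_norm (X : normedModType R) (x y : X) (r : R) :
  ball x r y <-> `|x - y| < r.
Proof. by rewrite -ball_normE. Qed.

(** The points 0 and - d are equidistant from every point of the ball where the
    norm has period d.  Points going off in the direction of d, far enough from
    that ball, complete them to a quasi-finite set; a ball centred there cannot
    contain exactly one point of it. *)
Lemma property_S_aperiodic (X : normedModType R) : property_S X -> aperiodic X.
Proof.
move=> S d d0 x0 e e0; apply: contrapT => H.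
have per x : `|x - x0| < e -> `|x + d| = `|x|.
  by move=> xe; apply: contrapT => /eqP ne; apply: H; exists x.
pose w := `|d|^-1 *: d.
have w1 : `|w| = 1 by rewrite normrZ normfV normr_id mulVf// normr_eq0.
(* All c k are farther than 0 from any point of the ball of periodicity. *)
pose L := `|x0| + 2 * e.
have L0 : 0 <= L by rewrite /L; have := normr_ge0 x0; lra.
pose c (k : nat) := x0 + (L + k%:R) *: w.
have cx0 k : `|c k - x0| = L + k%:R.
  by rewrite addrC addKr normrZ w1 mulr1 ger0_norm// addr_ge0.
have cinj : injective c.
  move=> k l kl; have : L + k%:R = L + l%:R :> R by rewrite -!cx0 kl.
  by move/addrI/eqP; rewrite eqr_nat => /eqP.
pose A : set X := [set 0; - d] `|` range c.
have [Y dY SY] : exists2 Y : set X, dense Y &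
    forall y : X, Y y -> forall n : nat, (0 < n)%N ->
        exists2 r : R, 0 < r & (A `&` ball y r #= `I_n)%card.
  apply: S; split.
    apply: (@sub_infinite_set _ (range c)); first by move=> x; right.
    rewrite (eq_finite_set (inj_card_eq (in2W cinj))); exact: infinite_nat.
  move=> x r r0; rewrite setIUl finite_setU; split; first exact: finite_setIl.
  pose m := (Num.truncn (r + `|x - x0|)).+1.
  apply: (@sub_finite_set _ _ (c @` `I_m)); last exact: finite_image.
  move=> _ [[k _ <-]] /ball_norm ck; exists k => //=.
  rewrite -(ltr_nat R); apply: lt_trans (truncnS_gt _).
  have := ler_distD x (c k) x0; rewrite cx0 distrC; lra.
have [y [/ball_norm yx0 Yy]] : ball x0 e `&` Y !=set0.
  apply: dY; first by exists x0; exact: ballxx.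
  exact: ball_open.
have [//|r r0] := SY _ Yy 1%N.
rewrite -(card_eqr (@card_set1 X 0)) => /card_esym /card_set_bijP[f [ffun finj fsurj]].
have inA p q : A p -> A q -> `|p - y| < r -> `|q - y| < r -> p = q.
  move=> Ap Aq pr qr.
  have [|_ -> <-] := fsurj p; first by split => //; apply/ball_norm; rewrite distrC.
  by have [|_ -> <-] := fsurj q; first by split => //; apply/ball_norm; rewrite distrC.
rewrite distrC in yx0.
have [yr|ry] := ltP `|y| r.
  move: d0; rewrite -oppr_eq0 => /eqP; apply.
  apply: inA; first by left; right.
  - by left; left.
  - by rewrite -opprD normrN addrC per.
  - by rewrite sub0r normrN.
have [[[->|->]|[k _ <-]] /ball_norm] := ffun 0 erefl.
- by rewrite subr0 ltNge ry.
- by rewrite opprK per// ltNge ry.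
have := ler_distD y (c k) x0; have := ler_distD x0 y 0.
rewrite !subr0 cx0 (distrC (c k)) /L; have : 0 <= k%:R :> R by [].
lra.
Qed.

Lemma exists_closest (T : eqType) (A B : set T) (g : T -> R) (p : T) :
  A p -> finite_set (A `&` B) -> (forall q, A q -> ~ B q -> g p < g q) ->
  exists2 a, A a & forall b, A b -> g a <= g b.
Proof.
move=> Ap /finite_seqP[s As] far.
have min (t : seq T) : {subset t <= s} -> exists2 a, A a &
    g a <= g p /\ forall b, b \in t -> g a <= g b.
  elim: t => [_|b t IH bts]; first by exists p.
  have [|a Aa [ap at_]] := IH; first by move=> z zt; apply: bts; rewrite inE zt orbT.
  have [ab|/ltW ba] := leP (g a) (g b).
    by exists a => //; split => // z; rewrite inE => /predU1P[->|/at_].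
  have [Ab _] : (A `&` B) b by rewrite As /=; apply: bts; rewrite mem_head.
  exists b => //; split; first exact: le_trans ba ap.
  by move=> z; rewrite inE => /predU1P[->//|/at_]; exact: le_trans.
have [//|a Aa [ap as_]] := min s.
exists a => // b Ab; have [Bb|/(far _ Ab)/ltW] := pselect (B b).
  by apply: as_; have : (A `&` B) b by []; rewrite As.
exact: le_trans.
Qed.

Lemma card_setU1_II (T : choiceType) (S : set T) (a : T) (n : nat) :
  ~ S a -> (S #= `I_n -> a |` S #= `I_n.+1)%card.
Proof.
move=> Sa /card_set_bijP[f [ffun finj fsurj]]; apply/card_set_bijP.
exists (fun z => if z == a then n else f z); split.
- move=> z /= [->|Sz]; first by rewrite eqxx.
  case: eqP => // _; exact: ltnW (ffun z Sz).
- have fn z : S z -> f z != n.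
    by move=> Sz; rewrite neq_ltn (ffun z Sz : (f z < n)%N).
  move=> z t; rewrite !inE => -[->|Sz] [->|St] //; rewrite ?eqxx.
  + by case: eqP => [->//|_ e]; have := fn t St; rewrite -e eqxx.
  + by case: eqP => [->//|_ e]; have := fn z Sz; rewrite e eqxx.
  + case: eqP => [za|_]; first by rewrite za in Sz.
    case: eqP => [ta|_]; first by rewrite ta in St.
    by apply: finj; rewrite inE.
- move=> m /=; rewrite ltnS leq_eqVlt => /predU1P[->|mn].
    by exists a; [left|rewrite eqxx].
  have [z Sz <-] := fsurj m mn; exists z; first by right.
  by case: eqP => // za; rewrite za in Sz.
Qed.

Lemma aperiodic_property_S (X : completeNormedModType R) :
  aperiodic X -> property_S X.
Proof.
move=> apX A [Ainf Afin].
have Acount : countable A.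
  have -> : A = \bigcup_(n : nat) (A `&` ball 0 n.+1%:R).
    apply/seteqP; split=> [x Ax|x [n _ []]//].
    exists (Num.truncn `|x|) => //; split => //; apply/ball_norm.
    by rewrite sub0r normrN truncnS_gt.
  by apply: bigcup_countable => // n _; apply: finite_set_countable; exact: Afin.
move: Acount => /countable_injP[code codeI].
(* F n is the set of centres telling apart the two points of A coded by n, if any. *)
pose F (n : nat) : set X := [set z | forall a b, A a -> A b -> a != b ->
   unpickle n = Some (code a, code b) -> `|z - a| != `|z - b|].
have FP n : open (F n) /\ dense (F n).
  have [[a [b [Aa Ab ab nab]]]|no] := pselect (exists a b,
      [/\ A a, A b, a != b & unpickle n = Some (code a, code b)]); last first.
    have -> : F n = setT.
      by apply/seteqP; split => // z _ a b Aa Ab ab nab; exfalso; apply: no; exists a, b.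
    by split; [exact: openT|move=> O O0 _; rewrite setIT].
  have -> : F n = [set z | `|z - a| != `|z - b|].
    apply/seteqP; split => [z /(_ a b)|z zab a' b' Aa' Ab' _]; first exact.
    rewrite nab => -[] /codeI aa' /codeI bb'.
    by rewrite -aa' ?inE// -bb' ?inE.
  split.
    have -> : [set z | `|z - a| != `|z - b|] =
        (fun z => `|z - a| - `|z - b|) @^-1` [set x | x != 0].
      by apply/seteqP; split => z /=; rewrite subr_eq0.
    apply: open_comp; last exact: open_neq.
    move=> z _; apply: cvgB; apply: cvg_norm; apply: cvgB => //; exact: cvg_cst.
  move=> O [z Oz] oO.
  have /nbhs_ballP[e /= e0 eO] : nbhs z O by exact: open_nbhs_nbhs.
  have ab0 : a - b != 0 by rewrite subr_eq0.
  have [x xz xab] := apX _ ab0 (z - a) e e0.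
  exists (x + a); split; last by rewrite /= addrK -addrA eq_sym.
  by apply: eO; apply/ball_norm; move: xz; rewrite opprB addrA distrC.
exists (\bigcap_n F n); first exact: Baire.
move=> y Yy.
have dist_inj a b : A a -> A b -> `|y - a| = `|y - b| -> a = b.
  move=> Aa Ab yab; apply: contrapT => /eqP ab.
  have /(_ a b Aa Ab ab) := Yy (pickle (code a, code b)) I.
  by rewrite pickleK yab eqxx => /(_ erefl).
have closest (B : set X) : infinite_set (A `\` B) ->
    exists2 a, (A `\` B) a & forall b, (A `\` B) b -> `|y - a| <= `|y - b|.
  move=> /infinite_setN0[p ABp].
  apply: (@exists_closest _ (A `\` B) (ball y (`|y - p| + 1)) (fun z => `|y - z|) p) => //.
    apply: (@sub_finite_set _ _ (A `&` ball y (`|y - p| + 1))); first by move=> z [[]].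
    by apply: Afin; rewrite ltr_wpDl.
  by move=> q _ /ball_norm; apply: contra_notP => /negP; rewrite -leNgt; lra.
have diffinf (B : set X) : finite_set (A `&` B) -> infinite_set (A `\` B).
  by move=> fB fAB; apply: Ainf; rewrite -(setUIDK A B) finite_setU.
(* Passing from n to n + 1 points: a is the next closest point of A, and the
   radius is the distance of the one after it. *)
have count n : exists2 r : R, 0 <= r &
    ((0 < n)%N -> 0 < r) /\ (A `&` ball y r #= `I_n)%card.
  elim: n => [|n [r r0 [_ An]]].
    exists 0 => //; split => //; rewrite II0 card_eq0; apply/eqP.
    by apply/seteqP; split => // z [_ /ball_norm]; rewrite ltNge normr_ge0.
  have rfin : finite_set (A `&` ball y r) by apply/finite_setP; exists n.
  have [|a [Aa aD] amin] := closest (ball y r); first exact: diffinf.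
  have [|b [Ab bD] bmin] := closest (ball y r `|` [set a]).
    apply: diffinf; rewrite setIUr finite_setU; split => //.
    by apply: finite_setIr; exact: finite_set1.
  have ab : `|y - a| < `|y - b|.
    rewrite lt_neqAle; apply/andP; split.
      apply/eqP => /dist_inj ab; apply: bD; right => /=; apply/esym; exact: ab.
    by apply: amin; split => // ybr; apply: bD; left.
  have ra : r <= `|y - a|.
    by rewrite leNgt; apply/negP => h; apply: aD; apply/ball_norm.
  exists `|y - b|; first exact: normr_ge0.
  split => [_|]; first exact: le_lt_trans ab.
  suff -> : A `&` ball y `|y - b| = a |` (A `&` ball y r).
    by apply: card_setU1_II => // -[].
  apply/seteqP; split => [z [Az /ball_norm zb]|z].
    apply: contrapT => zn; suff : ~ `|y - z| < `|y - b| by [].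
    apply/negP; rewrite -leNgt; apply: bmin; split => // -[zr|za]; apply: zn.
      by right.
    by left.
  move=> [->|[Az /ball_norm zr]]; split => //; apply/ball_norm => //.
  by rewrite (lt_trans zr)// (le_lt_trans ra ab).
by move=> n n0; have [r _ [/(_ n0) r0 An]] := count n; exists r.
Qed.

Lemma property_SP (X : completeNormedModType R) : property_S X <-> aperiodic X.
Proof. by split; [exact: property_S_aperiodic|exact: aperiodic_property_S]. Qed.

End property_S_characterization.

(** * Norms in dimension at most two *)

Lemma coercive_min (R : realType) (g : R -> R) (B : R) :
  continuous g -> (forall u, B < `|u| -> g 0 <= g u) ->
  exists u0, forall u, g u0 <= g u.
Proof.
move=> gc far; have B0 : 0 <= `|B| by [].
have [||u0 _ u0min] := @EVT_min R g (- `|B|) `|B|; first lra.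
  exact: continuous_subspaceT.
exists u0 => u; have [uB|Bu] := leP `|u| `|B|.
  by apply: u0min; rewrite in_itv /= -ler_norml.
apply: le_trans (far u _); last by rewrite (le_lt_trans (ler_norm B)).
by apply: u0min; rewrite in_itv /= oppr_le0 B0.
Qed.

Section planes.
Context {R : realType}.

Definition independent2 (V : lmodType R) (p q : V) : Prop :=
  forall a b : R, a *: p + b *: q = 0 -> a = 0 /\ b = 0.

Lemma independent2C (V : lmodType R) (p q : V) :
  independent2 p q -> independent2 q p.
Proof. by move=> pq a b; rewrite addrC => /pq[]. Qed.

Lemma independent2P (V : lmodType R) (p q : V) : q != 0 ->
  (forall a, p != a *: q) -> independent2 p q.
Proof.
move=> q0 pq a b ab; have a0 : a = 0.
  apply: contrapT => /eqP a0; have /negP := pq (- (a^-1 * b)); apply; apply/eqP.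
  apply: (scalerI a0); rewrite scalerA mulrN mulrA divff// mul1r scaleNr.
  by apply/eqP; rewrite -addr_eq0 ab.
split => //; move: ab; rewrite a0 scale0r add0r => /eqP.
by rewrite scaler_eq0 (negbTE q0) orbF => /eqP.
Qed.

(** The coordinates of p, q and x form three rows with at most two columns, so
    there is a nontrivial relation between these vectors. *)
Lemma dim_le2_span (V : lmodType R) (p q : V) : dim_le V 2 ->
  independent2 p q -> forall x, exists a b : R, x = a *: p + b *: q.
Proof.
move=> [m m2 [e eP]] pq x.
have /choice[co coE] : forall v : V, exists c : 'rV[R]_m, v = \sum_(i < m) c 0 i *: e i.
  by move=> v; have [c [cE _]] := eP v; exists c.
pose w (j : 'I_3) := [:: p; q; x]`_j.
pose A : 'M[R]_(3, m) := \matrix_(j, i) co (w j) 0 i.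
have : kermx A != 0.
  rewrite -mxrank_eq0 mxrank_ker -lt0n subn_gt0.
  by rewrite (leq_ltn_trans (rank_leq_col A)).
move=> /rowV0Pn[u /sub_kermxP uA u0].
have comb : \sum_(j < 3) u 0 j *: w j = 0.
  rewrite (eq_bigr (fun j => \sum_i (u 0 j * co (w j) 0 i) *: e i)); last first.
    move=> j _; rewrite [in LHS](coE (w j)) scaler_sumr.
    by apply: eq_bigr => i _; rewrite scalerA.
  rewrite exchange_big /= big1// => i _; rewrite -scaler_suml.
  have /rowP/(_ i) := uA; rewrite !mxE.
  by under eq_bigr do rewrite mxE; move=> ->; rewrite scale0r.
move: comb; rewrite !big_ord_recl big_ord0 addr0 /w /=.
set a := u _ _; set b := u _ _; set c := u _ _ => abc.
have [c0|c0] := eqVneq c 0.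
  move: abc; rewrite c0 scale0r addr0 => /pq[a0 b0].
  case/eqP: u0; apply/rowP => j; rewrite mxE.
  move: c0 a0 b0; rewrite /a /b /c => c0 a0 b0.
  case: j => -[|[|[|//]]] h.
  - by rewrite -[RHS]a0; congr (u _ _); apply/val_inj.
  - by rewrite -[RHS]b0; congr (u _ _); apply/val_inj.
  - by rewrite -[RHS]c0; congr (u _ _); apply/val_inj.
exists (- (c^-1 * a)), (- (c^-1 * b)); apply: (scalerI c0).
rewrite scalerDr !scalerA !mulrN !mulrA divff// !mul1r !scaleNr -opprD.
by apply/eqP; rewrite -addr_eq0 addrC -addrA abc.
Qed.

Lemma not_dim_le2_span (V : lmodType R) (p q : V) : ~ dim_le V 2 ->
  independent2 p q -> exists x, forall a b : R, x <> a *: p + b *: q.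
Proof.
move=> dimV pq; apply: contrapT => /forallNP H; apply: dimV.
exists 2%N => //; exists (fun i : 'I_2 => [:: p; q]`_i) => x.
have /existsNP[a /existsNP[b /contrapT ->]] := H x.
exists (\row_(i < 2) [:: a; b]`_i); split.
  by rewrite !big_ord_recl big_ord0 addr0 !mxE.
move=> c; rewrite !big_ord_recl big_ord0 addr0 /= => /eqP.
rewrite eq_sym -subr_eq0 opprD addrACA -!scalerBl => /eqP /pq[/eqP + /eqP].
rewrite !subr_eq0 => /eqP c0 /eqP c1; apply/rowP => -[[|[|//]] h]; rewrite mxE /=.
- by rewrite -c0; congr (c _ _); apply/val_inj.
- by rewrite -c1; congr (c _ _); apply/val_inj.
Qed.

Lemma not_dim_le2_line (V : lmodType R) (q : V) : ~ dim_le V 2 ->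
  exists x, forall b : R, x <> b *: q.
Proof.
move=> dimV; apply: contrapT => /forallNP H; apply: dimV.
have {}H x : exists b, x = b *: q by have /existsNP[b /contrapT] := H x; exists b.
have [q0|q0] := eqVneq q 0.
  exists 0%N => //; exists (fun=> 0) => x; have [b ->] := H x.
  by rewrite q0 scaler0; exists 0; split => [|c _]; [rewrite big_ord0|apply/rowP; case].
exists 1%N => //; exists (fun=> q) => x; have [a ->] := H x.
exists (\row_(i < 1) a); split; first by rewrite big_ord1 mxE.
move=> c; rewrite big_ord1 => ce; apply/rowP => i; rewrite mxE ord1.
apply/eqP; rewrite -subr_eq0; have /eqP : (a - c 0 0) *: q = 0.
  by rewrite scalerBl ce subrr.
by rewrite scaler_eq0 (negbTE q0) orbF.
Qed.

Lemma not_dim_le2_plane (V : lmodType R) (p q : V) : ~ dim_le V 2 ->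
  exists x, forall a b : R, x <> a *: p + b *: q.
Proof.
move=> dimV; have [/not_dim_le2_span|dep] := pselect (independent2 p q); first exact.
have [q0|q0] := eqVneq q 0.
  have [x xp] := not_dim_le2_line p dimV; exists x => a b.
  by rewrite q0 scaler0 addr0; exact: xp.
have [c pE] : exists c, p = c *: q.
  by apply: contrapT => /forallNP pq; apply/dep/independent2P => // a; apply/eqP.
have [x xq] := not_dim_le2_line q dimV; exists x => a b.
by rewrite pE scalerA -scalerDl; exact: xq.
Qed.

(** The constant is the distance from p to the line spanned by q, which is attained
    and hence positive. *)
Lemma independent2_coord (X : normedModType R) (p q : X) : independent2 p q ->
  exists2 c : R, 0 < c & forall a b : R, c * `|a| <= `|a *: p + b *: q|.
Proof.
move=> pq.
have q0 : q != 0.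
  apply/eqP => q0; have [|_ /eqP] := pq 0 1; first by rewrite q0 scaler0 scale0r addr0.
  by rewrite oner_eq0.
have nq : 0 < `|q| by rewrite normr_gt0.
have [||u0 u0P] := @coercive_min R (fun u => `|p + u *: q|) (2 * `|p| / `|q|).
- move=> u; apply: cvg_norm; apply: cvgD; first exact: cvg_cst.
  exact: scalel_continuous.
- move=> u; rewrite ltr_pdivrMr// scale0r addr0 -normrZ.
  have := ler_normD (p + u *: q) (- p); rewrite addrC addKr normrN; lra.
exists `|p + u0 *: q|.
  rewrite normr_gt0; apply/eqP; rewrite -[p]scale1r => /pq[/eqP].
  by rewrite oner_eq0.
move=> a b; have [->|a0] := eqVneq a 0; first by rewrite normr0 mulr0.
have -> : a *: p + b *: q = a *: (p + (a^-1 * b) *: q).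
  by rewrite scalerDr scalerA mulrA divff// mul1r.
by rewrite normrZ mulrC ler_wpM2l.
Qed.

(** Independent vectors p and q with |p + q| = |p| + |q| span an open cone on which
    |a p + b q| = a |p| + b |q|, so that the norm has there as period any small
    multiple of |q| p - |p| q. *)
Lemma aperiodic_strictly_convex (X : normedModType R) :
  dim_le X 2 -> aperiodic X -> strictly_convex X.
Proof.
move=> dimX apX; apply/strictly_convexP => p q pq; apply: contrapT => /eqP npq.
have p0 : 0 < `|p|.
  by rewrite normr_gt0; apply: contraNneq npq => ->; rewrite normr0 scaler0 scale0r.
have q0 : 0 < `|q|.
  by rewrite normr_gt0; apply: contraNneq npq => ->; rewrite normr0 scaler0 scale0r.
have cone a b := @additive_cone _ _ _ (norm_is_seminorm X) p q a b pq.
have ind : independent2 p q.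
  apply: independent2P => [|a]; first by rewrite -normr_gt0.
  apply: contraNneq npq => pE.
  have [a0|a0] := leP 0 a.
    by rewrite pE normrZ ger0_norm// scalerA mulrC.
  have na0 : 0 <= - a by lra.
  have := cone 1 (- a) ler01 na0.
  rewrite [X in `|X|](_ : _ = 0); last by rewrite scale1r scaleNr -pE subrr.
  by rewrite normr0; nra.
have [c1 c10 c1P] := independent2_coord ind.
have [c2 c20 c2P] := independent2_coord (independent2C ind).
(* With this k, adding d changes the coordinates by at most 1/2. *)
pose k := (2 * (`|p| + `|q|))^-1.
have k0 : 0 < k by rewrite invr_gt0; lra.
have kE : k * (2 * (`|p| + `|q|)) = 1 by rewrite mulVf//; apply/eqP; lra.
pose d := k *: (`|q| *: p - `|p| *: q).
have d0 : d != 0 by rewrite scaler_eq0 subr_eq0 (negbTE npq) orbF gt_eqF.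
pose e := Num.min (c1 / 2) (c2 / 2).
have e0 : 0 < e by rewrite lt_min !divr_gt0.
have [x xe] := apX d d0 (p + q) e e0.
have [a [b xE]] := dim_le2_span dimX ind x.
have xB : x - (p + q) = (a - 1) *: p + (b - 1) *: q.
  by rewrite xE !scalerBl !scale1r opprD addrACA.
have a1 : `|a - 1| <= 2^-1.
  rewrite -(ler_pM2l c10) (le_trans (c1P _ (b - 1)))// -xB ltW// (lt_le_trans xe)//.
  by rewrite ge_min lexx.
have b1 : `|b - 1| <= 2^-1.
  rewrite -(ler_pM2l c20) (le_trans (c2P _ (a - 1)))// addrC -xB ltW// (lt_le_trans xe)//.
  by rewrite ge_min lexx orbT.
move: a1 b1; rewrite !ler_norml => /andP[a1 _] /andP[b1 _].
case/eqP; have -> : x + d = (a + k * `|q|) *: p + (b - k * `|p|) *: q.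
  by rewrite xE /d scalerBr !scalerA addrACA -scalerDl -scalerBl.
by rewrite xE !cone; nra.
Qed.

End planes.

(** * Completeness and composition of renormings *)

Lemma renormed_complete (R : realType) (X : completeNormedModType R)
    (N : equivalent_norm X) (F : set_system (renormed N)) :
  ProperFilter F -> cauchy F -> cvg F.
Proof.
move=> FF Fc; have [m [M [m0 M0 mM]]] := eqv_norm_equiv N.
pose G : set_system X := F.
have GF : ProperFilter G := FF.
have Gc : cauchy G.
  apply/cauchyP => e e0.
  have /cauchyP/(_ (m * e) (mulr_gt0 m0 e0))[x Fx] := Fc.
  exists x; apply: filterS Fx => y /ball_norm xy; apply/ball_norm.
  by rewrite -(ltr_pM2l m0) (le_lt_trans _ xy)//; have /andP[] := mM (x - y).
have Gl : cvg G by exact: cauchy_cvg.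
apply/cvg_ex; exists (lim G) => A.
rewrite -nbhs_ballE => -[e /= e0 eA].
apply: (filterS eA); have {}Gl := Gl (ball (lim G) (e / M)).
apply: filterS (Gl (nbhsx_ballx _ _ (divr_gt0 e0 M0))) => y /ball_norm.
rewrite ltr_pdivlMr// mulrC => Gy; apply/ball_norm.
by apply: le_lt_trans Gy; have /andP[] := mM (lim G - y).
Qed.

HB.instance Definition _ (R : realType) (X : completeNormedModType R)
  (N : equivalent_norm X) :=
  Uniform_isComplete.Build (renormed N) (@renormed_complete R X N).

Section compose.
Context {R : realType} {X : normedModType R} (N : equivalent_norm X).

Lemma eqv_norm_comp_equiv (N' : equivalent_norm (renormed N)) :
  exists m M : R, [/\ 0 < m, 0 < M &
    forall x : X, m * `|x| <= eqv_norm N' x <= M * `|x|].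
Proof.
have [m [M [m0 M0 mM]]] := eqv_norm_equiv N.
have [m' [M' [m'0 M'0 mM']]] := eqv_norm_equiv N'.
exists (m' * m), (M' * M); split; [exact: mulr_gt0|exact: mulr_gt0|move=> x].
have /andP[h1 h2] := mM x; have /andP[h3 h4] := mM' x.
rewrite -!mulrA; apply/andP; split.
  by apply: le_trans h3; rewrite ler_pM2l.
by apply: (le_trans h4); rewrite ler_pM2l.
Qed.

Definition eqv_norm_comp (N' : equivalent_norm (renormed N)) : equivalent_norm X :=
  @EquivalentNorm R X (eqv_norm N') (@eqv_normD _ _ N') (@eqv_normZ _ _ N')
    (@eqv_norm_eq0 _ _ N') (eqv_norm_comp_equiv N').

(** Strict convexity and aperiodicity only involve the norm and the vector space,
    which are the same on both sides; the two topologies are different terms. *)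
Lemma strictly_convex_comp (N' : equivalent_norm (renormed N)) :
  strictly_convex (renormed (eqv_norm_comp N')) <-> strictly_convex (renormed N').
Proof. by []. Qed.

Lemma aperiodic_comp (N' : equivalent_norm (renormed N)) :
  aperiodic (renormed (eqv_norm_comp N')) <-> aperiodic (renormed N').
Proof. by []. Qed.

End compose.

(** * A renorming which is not strictly convex *)

Section spike.
Context {R : realType} {X : normedModType R} (e : X).
Hypothesis e1 : `|e| = 1.

(** The infimum of [spike_cost x] is the gauge at x of the convex hull of the unit
    ball and of the points 2 e and - 2 e.  It is attained, so that the norm can be
    defined by choosing a minimiser. *)
Definition spike_cost (x : X) (t : R) : R := `|x - t *: e| + `|t| / 2.

Lemma spike_cost_min (x : X) : exists t, forall s, spike_cost x t <= spike_cost x s.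
Proof.
apply: (@coercive_min R _ (2 * `|x|)) => [t|s xs].
  apply: cvgD.
    apply: cvg_norm; apply: cvgB; first exact: cvg_cst.
    exact: scalel_continuous.
  by apply: cvgM; [exact: cvg_norm|exact: cvg_cst].
rewrite /spike_cost scale0r subr0 normr0.
by have := normr_ge0 (x - s *: e); lra.
Qed.

Definition spike_height (x : X) : R := projT1 (cid (spike_cost_min x)).
Definition spike_norm (x : X) : R := spike_cost x (spike_height x).

Lemma spike_norm_le x t : spike_norm x <= spike_cost x t.
Proof. exact: (projT2 (cid (spike_cost_min x))). Qed.

Lemma spike_normD x y : spike_norm (x + y) <= spike_norm x + spike_norm y.
Proof.
apply: le_trans (spike_norm_le _ (spike_height x + spike_height y)) _.
rewrite /spike_norm /spike_cost scalerDl opprD addrACA.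
have := ler_normD (x - spike_height x *: e) (y - spike_height y *: e).
have := ler_normD (spike_height x) (spike_height y); lra.
Qed.

Lemma spike_normZ_le a x : spike_norm (a *: x) <= `|a| * spike_norm x.
Proof.
apply: le_trans (spike_norm_le _ (a * spike_height x)) _.
by rewrite /spike_norm /spike_cost -scalerA -scalerBr normrZ normrM mulrDr mulrA.
Qed.

Lemma spike_norm_ge x : 2^-1 * `|x| <= spike_norm x.
Proof.
rewrite /spike_norm /spike_cost.
have := ler_normD (x - spike_height x *: e) (spike_height x *: e).
rewrite subrK normrZ e1; have := normr_ge0 (x - spike_height x *: e); lra.
Qed.

Lemma spike_norm_le_norm x : spike_norm x <= 1 * `|x|.
Proof.
apply: le_trans (spike_norm_le _ 0) _.
by rewrite /spike_cost scale0r subr0 normr0; lra.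
Qed.

Lemma spike_normZ a x : spike_norm (a *: x) = `|a| * spike_norm x.
Proof.
apply/eqP; rewrite eq_le spike_normZ_le /=.
have [->|a0] := eqVneq a 0.
  by rewrite normr0 mul0r (le_trans _ (spike_norm_ge _))// mulr_ge0// invr_ge0.
have := spike_normZ_le a^-1 (a *: x); rewrite scalerA mulVf// scale1r normfV.
by rewrite mulrC ler_pdivlMr ?normr_gt0// mulrC.
Qed.

Lemma spike_norm_eq0 x : spike_norm x = 0 -> x = 0.
Proof.
move=> x0; apply/eqP; rewrite -normr_eq0; have := spike_norm_ge x.
by rewrite x0 eq_le normr_ge0 andbT; lra.
Qed.

Lemma spike_norm_equiv : exists m M : R, [/\ 0 < m, 0 < M &
  forall x, m * `|x| <= spike_norm x <= M * `|x|].
Proof.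
exists 2^-1, 1; split => // x; by rewrite spike_norm_ge spike_norm_le_norm.
Qed.

Definition spike : equivalent_norm X :=
  EquivalentNorm spike_normD spike_normZ spike_norm_eq0 spike_norm_equiv.

(** Near e, where the norm is close to 1/2, the minimiser t is not 0.  Then the
    norm is additive on x - t e and t e, which are not parallel. *)
Lemma spike_not_strictly_convex (v : X) : (forall b, v <> b *: e) ->
  ~ strictly_convex (renormed spike).
Proof.
move=> ve /strictly_convexP sc.
have nv := normr_ge0 v.
(* With this k, [spike_cost x] is smaller at 1 than at 0. *)
pose k := (8 * (`|v| + 1))^-1.
have k0 : 0 < k by rewrite invr_gt0; lra.
have kE : k * (8 * (`|v| + 1)) = 1 by rewrite mulVf//; apply/eqP; lra.
pose x := e + k *: v; pose t := spike_height x.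
have nkv : `|k *: v| = k * `|v| by rewrite normrZ gtr0_norm.
have t0 : t != 0.
  apply/negP => /eqP t0; have := spike_norm_le x 1.
  rewrite /spike_norm -/t t0 /spike_cost scale0r subr0 normr0 scale1r normr1.
  rewrite /x addrAC subrr add0r nkv.
  have := ler_normD (e + k *: v) (- (k *: v)); rewrite addrK normrN nkv e1.
  move=> h1 h2.
  suff : (1 : R) < 1 by rewrite ltxx.
  lra.
pose u := x - t *: e.
have ute : u + t *: e = x by rewrite subrK.
have nx : spike_norm x = `|u| + `|t| / 2 by [].
have eqn : spike_norm (u + t *: e) = spike_norm u + spike_norm (t *: e).
  apply/eqP; rewrite eq_le spike_normD /= ute nx.
  have := spike_norm_le_norm u; have := spike_norm_le (t *: e) t.
  rewrite /spike_cost subrr normr0; lra.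
have := sc (u : renormed spike) (t *: e : renormed spike) eqn.
move=> H; have {H} : spike_norm (t *: e) *: u = spike_norm u *: (t *: e) := H.
set a := spike_norm (t *: e); set b := spike_norm u => ab.
have a0 : a != 0.
  apply/eqP => /spike_norm_eq0 /eqP; rewrite scaler_eq0 (negbTE t0) /=.
  by rewrite -normr_eq0 e1 oner_eq0.
have ak0 : a * k != 0 by rewrite mulf_neq0// gt_eqF.
apply: (ve ((a * k)^-1 * (b * t - a * (1 - t)))).
apply: (scalerI ak0); rewrite scalerA mulrA divff// mul1r scalerBl -!scalerA -ab.
rewrite -scalerBr; congr (_ *: _).
by rewrite /u /x scalerBl scale1r opprB addrA subrK addrAC subrr add0r.
Qed.

(** Let u = x - t e and u' = x + d - t' e with t and t' the minimisers at x and at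
    x + d.  Additivity on x, x + d gives |u + u'| = |u| + |u'| and
    |t + t'| = |t| + |t'|.  By strict convexity u and u' are parallel, which puts x in
    the span of d and e unless u = u' and t = t', in which case d = 0. *)
Lemma spike_aperiodic : ~ dim_le X 2 -> strictly_convex X ->
  aperiodic (renormed spike).
Proof.
move=> dimX /strictly_convexP sc d d0 x0 r r0; apply: contrapT => H.
have per (x : renormed spike) : `|x - x0| < r -> `|x + d| = `|x|.
  by move=> xr; apply: contrapT => /eqP ne; apply: H; exists x.
have [x xr xde] : exists2 x : renormed spike, `|x - x0| < r &
    forall a b, x <> a *: d + b *: (e : renormed spike).
  have [z zde] := not_dim_le2_plane (d : X) e dimX.
  have [x0de|] := pselect (exists a b, (x0 : X) = a *: d + b *: e); last first.
    move=> h; exists x0; first by rewrite subrr normr0.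
    by move=> a b E; apply: h; exists a, b.
  have [a0 [b0 x0E]] := x0de.
  pose k := r / (2 * (`|z : renormed spike| + 1)).
  have nz := normr_ge0 (z : renormed spike).
  have nz1 : 0 < 2 * (`|z : renormed spike| + 1) by lra.
  have k0 : 0 < k by rewrite divr_gt0.
  have kE : k * (2 * (`|z : renormed spike| + 1)) = r by rewrite mulfVK// gt_eqF.
  exists (x0 + k *: (z : renormed spike)).
    by rewrite addrC addKr normrZ gtr0_norm//; nra.
  move=> a b E; apply: (zde (k^-1 * (a - a0)) (k^-1 * (b - b0))).
  apply: (scalerI (lt0r_neq0 k0)); rewrite scalerDr !scalerA !mulrA divff ?gt_eqF//.
  rewrite !mul1r !scalerBl addrACA -opprD -x0E.
  by rewrite -E addrAC subrr add0r.
have add := periodic_additive per xr; have {}per := per _ xr.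
pose t := spike_height x; pose t' := spike_height (x + d).
pose u : X := x - t *: e; pose u' : X := (x : X) + d - t' *: e.
have nx : spike_norm x = `|u| + `|t| / 2 by [].
have nxd : spike_norm ((x : X) + d) = `|u'| + `|t'| / 2 by [].
have {}per : spike_norm ((x : X) + d) = spike_norm x := per.
have {}add : spike_norm ((x : X) + (x + d)) = spike_norm x + spike_norm ((x : X) + d) := add.
have := spike_norm_le ((x : X) + (x + d)) (t + t').
have -> : spike_cost ((x : X) + (x + d)) (t + t') = `|u + u'| + `|t + t'| / 2.
  by rewrite /spike_cost /u /u' [in RHS]addrACA -opprD -scalerDl.
have uu := ler_normD u u'; have tt := ler_normD t t'.
rewrite {}add {}nx {}nxd in per * => le.
have /sc E : `|u + u'| = `|u| + `|u'| by lra.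
have {uu}tt' : `|t + t'| = `|t| + `|t'| by lra.
have nuu : `|u'| = `|u|.
  apply/eqP; rewrite -subr_eq0; apply/negP => /negP nuu.
  apply: (xde ((`|u'| - `|u|)^-1 * `|u|) ((`|u'| - `|u|)^-1 * (`|u'| * t - `|u| * t'))).
  apply: (scalerI nuu); rewrite scalerDr !scalerA !mulrA divff// !mul1r.
  move: E; set al := `|u'|; set be := `|u|; rewrite /u /u'.
  rewrite !scalerBr !scalerDr !scalerA !scalerBl => /eqP; rewrite subr_eq => /eqP ->.
  by rewrite [LHS]addrC -!addrA addKr [- _ + _]addrC.
have u0 : `|u| != 0.
  rewrite normr_eq0 subr_eq0; apply/negP => /eqP xE; apply: (xde 0 t).
  by rewrite scale0r add0r; exact: xE.
have uE : u = u' by apply: (scalerI u0); rewrite -E nuu.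
have tE : t' = t.
  have tt1 : `|t'| = `|t| by lra.
  move: tt'; rewrite tt1; move/eqP: tt1; rewrite eqr_norm2 => /orP[/eqP//|/eqP ->].
  rewrite subrr normr0 => h; have /normr0_eq0 -> : `|t| = 0 by lra.
  by rewrite oppr0.
move/eqP: d0; apply; have : (x : X) + d = x.
  by apply: (@addIr _ (- (t *: e))); rewrite -{1}tE; exact/esym.
by move/eqP; rewrite -subr_eq0 addrC addKr => /eqP.
Qed.

End spike.

Lemma exists_spike (R : realType) (X : normedModType R) : ~ dim_le X 2 ->
  strictly_convex X -> exists N : equivalent_norm X,
  ~ strictly_convex (renormed N) /\ aperiodic (renormed N).
Proof.
move=> dimX scX; have [e0 /(_ 0)] := not_dim_le2_line (0 : X) dimX.
rewrite scaler0 => /eqP e00; pose e := `|e0|^-1 *: e0.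
have e1 : `|e| = 1 by rewrite normrZ normfV normr_id mulVf// normr_eq0.
have [v ve] := not_dim_le2_line e dimX.
exists (spike e1); split; first exact: spike_not_strictly_convex ve.
exact: spike_aperiodic.
Qed.

Lemma exists_nonstrictly_convex_renorming (R : realType)
    (X : completeNormedModType R) : ~ dim_le X 2 ->
  (exists N : equivalent_norm X, property_S (renormed N)) ->
  exists N : equivalent_norm X,
    ~ strictly_convex (renormed N) /\ property_S (renormed N).
Proof.
move=> dimX [N SN]; have [sc|nsc] := pselect (strictly_convex (renormed N)).
  have [N' [nsc aper]] := exists_spike (X := renormed N) dimX sc.
  exists (eqv_norm_comp N'); split; first by move=> /strictly_convex_comp.
  by apply/property_SP/aperiodic_comp.
by exists N.
Qed.

(** * The sum of c_0 and l_oo *)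

Section sup_over.
Context {R : realType} {T : Type}.
Implicit Types (A : set T) (f : T -> R).

Definition sup_over A f : R := sup (f @` A).

Lemma sup_over_le A f (M : R) : 0 <= M -> (forall t, A t -> f t <= M) ->
  sup_over A f <= M.
Proof.
move=> M0 fM; have [->|/set0P[t At]] := eqVneq A set0.
  by rewrite /sup_over image_set0 sup0.
apply: ge_sup; first by exists (f t); exists t.
by move=> _ [s As <-]; exact: fM.
Qed.

Lemma le_sup_over A f (M : R) t : (forall t, A t -> f t <= M) -> A t ->
  f t <= sup_over A f.
Proof.
move=> fM At; apply: ub_le_sup; last by exists t.
by exists M => _ [s As <-]; exact: fM.
Qed.

Lemma sup_over_max A f t : A t -> (forall s, A s -> f s <= f t) ->
  sup_over A f = f t.
Proof.
move=> At ft; apply/eqP; rewrite eq_le (le_sup_over ft At) andbT.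
by apply: ge_sup => [|_ [s As <-]]; [exists (f t); exists t|exact: ft].
Qed.

Lemma sup_over_seminorm (V : lmodType R) (n : T -> V -> R) (B : V -> R) A :
  (forall t, is_seminorm (n t)) -> (forall t x, A t -> n t x <= B x) ->
  is_seminorm (fun x => sup_over A (n^~ x)).
Proof.
move=> hn nB; have B0 x : 0 <= sup_over A (n^~ x).
  have [->|/set0P[t At]] := eqVneq A set0.
    by rewrite /sup_over image_set0 sup0.
  by apply: le_trans (le_sup_over (nB^~ x) At); exact: seminorm_ge0.
have leZ a x : sup_over A (n^~ (a *: x)) <= `|a| * sup_over A (n^~ x).
  apply: sup_over_le => [|t At]; first by rewrite mulr_ge0.
  by rewrite (hn t).2 ler_wpM2l// (le_sup_over (nB^~ x)).
split=> [x y|a x].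
  apply: sup_over_le => [|t At]; first by rewrite addr_ge0.
  by rewrite (le_trans ((hn t).1 _ _))// lerD// (le_sup_over (nB^~ _)).
apply/eqP; rewrite eq_le leZ /=; have [->|a0] := eqVneq a 0.
  by rewrite normr0 mul0r.
have := leZ a^-1 (a *: x); rewrite scalerA mulVf// scale1r normfV.
by rewrite mulrC ler_pdivlMr ?normr_gt0// mulrC.
Qed.

End sup_over.

Section c0_linf.
Context {R : realType} (T : Type) (S : set T).

(** For S = T this is c_0(T), and for S empty it is l_oo(T). *)
Definition c0_linf_pred : {pred T -> R} := mem [set f : T -> R |
  (exists M, forall t, `|f t| <= M) /\
  (forall e, 0 < e -> finite_set [set t | S t /\ e <= `|f t|])].

Lemma c0_linf_submod : submod_closed c0_linf_pred.
Proof.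
split.
  rewrite inE; split; first by exists 0 => t; rewrite normr0.
  move=> e e0; rewrite [X in finite_set X](_ : _ = set0)//.
  by apply/seteqP; split => // t [_]; rewrite normr0 leNgt e0.
move=> a f g /set_mem[[M fM] fS] /set_mem[[L gL] gS]; rewrite inE; split.
  exists (`|a| * M + L) => t; rewrite (le_trans (ler_normD _ _))// lerD//.
  by rewrite normrM ler_wpM2l.
move=> e e0; pose d := e / (2 * (`|a| + 1)).
have a1 : 0 < 2 * (`|a| + 1) by have := normr_ge0 a; lra.
have d0 : 0 < d by rewrite divr_gt0.
have e2 : 0 < e / 2 by lra.
have dE : d * (2 * (`|a| + 1)) = e by rewrite mulfVK// gt_eqF.
apply: (@sub_finite_set _ _ ([set t | S t /\ d <= `|f t|] `|`
    [set t | S t /\ e / 2 <= `|g t|])); last by rewrite finite_setU; split; auto.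
move=> t [St et]; have [ft|ft] := leP d `|f t|; first by left.
right; split => //; have := ler_normD (a * f t) (g t); rewrite normrM.
have : e <= `|a * f t + g t| by [].
have := normr_ge0 a; have := normr_ge0 (f t); nra.
Qed.

HB.instance Definition _ := GRing.isSubmodClosed.Build _ _ c0_linf_pred
  c0_linf_submod.

Definition c0_linf := {f : T -> R | f \in c0_linf_pred}.
HB.instance Definition _ := [isSub of c0_linf for sval].
HB.instance Definition _ := [Choice of c0_linf by <:].
HB.instance Definition _ := [SubChoice_isSubLmodule of c0_linf by <:].

Definition c0_linf_fun (z : c0_linf) : T -> R := val z.
Coercion c0_linf_fun : c0_linf >-> Funclass.

Lemma c0_linfP (z : c0_linf) : (exists M, forall t, `|z t| <= M) /\
  (forall e, 0 < e -> finite_set [set t | S t /\ e <= `|z t|]).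
Proof. exact: set_mem (valP z). Qed.

Lemma c0_linf_exists (f : T -> R) : (exists M, forall t, `|f t| <= M) ->
  (forall e, 0 < e -> finite_set [set t | S t /\ e <= `|f t|]) ->
  exists z : c0_linf, forall t, z t = f t.
Proof.
move=> fM fS; have fin : f \in c0_linf_pred by rewrite inE.
by exists (exist _ f fin).
Qed.

Lemma c0_linfD (x y : c0_linf) t : (x + y : c0_linf) t = x t + y t. Proof. by []. Qed.
Lemma c0_linfZ a (x : c0_linf) t : (a *: x : c0_linf) t = a * x t. Proof. by []. Qed.
Lemma c0_linf0 t : (0 : c0_linf) t = 0. Proof. by []. Qed.

Lemma c0_linf_eq (x y : c0_linf) : (forall t, x t = y t) -> x = y.
Proof. by move=> xy; apply/val_inj/funext. Qed.

Definition c0_linf_norm (z : c0_linf) : R := sup_over setT (fun t => `|z t|).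

Lemma c0_linf_norm_le (z : c0_linf) M : 0 <= M -> (forall t, `|z t| <= M) ->
  c0_linf_norm z <= M.
Proof. by move=> M0 zM; apply: sup_over_le. Qed.

Lemma c0_linf_le_norm (z : c0_linf) t : `|z t| <= c0_linf_norm z.
Proof.
by have [[M zM] _] := c0_linfP z; exact: (@le_sup_over _ _ setT (fun t => `|z t|) M).
Qed.

Lemma c0_linf_norm_seminorm : is_seminorm c0_linf_norm.
Proof.
apply: (@sup_over_seminorm _ _ _ (fun t (z : c0_linf) => `|z t|) c0_linf_norm).
  move=> t; split=> [x y|a x]; first exact: ler_normD.
  by rewrite c0_linfZ normrM.
by move=> t x _; exact: c0_linf_le_norm.
Qed.

Lemma c0_linf_norm_eq0 z : c0_linf_norm z = 0 -> z = 0.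
Proof.
move=> z0; apply: c0_linf_eq => t; apply/normr0_eq0/eqP.
by rewrite eq_le normr_ge0 andbT -z0 c0_linf_le_norm.
Qed.

HB.instance Definition _ := @Lmodule_isNormed.Build R c0_linf c0_linf_norm
  c0_linf_norm_seminorm.1 c0_linf_norm_seminorm.2 c0_linf_norm_eq0.

Lemma c0_linf_dist (x y : c0_linf) t : `|x t - y t| <= `|x - y|.
Proof. exact: (c0_linf_le_norm (x - y : c0_linf) t). Qed.

Lemma c0_linf_dist_le (x y : c0_linf) (e : R) : 0 <= e ->
  (forall t, `|x t - y t| <= e) -> `|x - y| <= e.
Proof. exact: (@c0_linf_norm_le (x - y : c0_linf) e). Qed.

(** The limit is taken pointwise.  A function of the filter at distance e from all
    its later elements stays at distance e from the pointwise limit, which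
    therefore lies in the space and is a uniform limit. *)
Lemma c0_linf_complete (F : set_system c0_linf) :
  ProperFilter F -> cauchy F -> cvg F.
Proof.
move=> FF Fc.
have Fe e : 0 < e -> exists y : c0_linf, F (ball y e).
  by move=> e0; have /cauchyP/(_ e e0) := Fc.
pose ev (t : T) (z : c0_linf) : R := z t.
have evc t : cvg (ev t @ F).
  apply: cauchy_cvg; apply/cauchyP => e e0; have [y Fy] := Fe e e0.
  exists (y t); suff : F (ev t @^-1` ball (y t) e) by [].
  apply: filterS Fy => z /ball_norm yz; apply/ball_norm.
  exact: le_lt_trans (c0_linf_dist y z t) yz.
pose l (t : T) : R := lim (ev t @ F).
have near_l (y : c0_linf) e : 0 < e -> F (ball y e) -> forall t, `|y t - l t| <= e.
  move=> e0 Fy t; apply/ler_addgt0Pr => d d0.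
  have /cvgrPdist_lt/(_ d d0) Fl := evc t.
  have [z [/ball_norm yz zl]] := filter_ex (filterI Fy Fl).
  apply: le_trans (ler_distD (z t) _ _) _; rewrite lerD//.
    exact: le_trans (c0_linf_dist y z t) (ltW yz).
  by rewrite distrC ltW.
have [z zE] : exists z : c0_linf, forall t, z t = l t.
  apply: c0_linf_exists.
    have [y Fy] := Fe 1 ltr01; have [[M yM] _] := c0_linfP y.
    exists (M + 1) => t; have := near_l y 1 ltr01 Fy t; have := yM t.
    have := ler_distD (y t) 0 (l t); rewrite !sub0r !normrN; lra.
  move=> e e0; have e2 : 0 < e / 2 by lra.
  have [y Fy] := Fe (e / 2) e2; have [_ yS] := c0_linfP y.
  apply: sub_finite_set (yS (e / 2) e2) => t [St et]; split => //.
  have := near_l y (e / 2) e2 Fy t.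
  have := ler_distD (y t) 0 (l t); rewrite !sub0r !normrN; lra.
apply/cvg_ex; exists z => A; rewrite -nbhs_ballE => -[e /= e0 eA].
have e3 : 0 < e / 3 by lra.
have [y Fy] := Fe (e / 3) e3; apply: (filterS eA).
apply: filterS (Fy) => w /ball_norm yw; apply/ball_norm.
have zy : `|z - y| <= e / 3.
  by apply: c0_linf_dist_le => [|t]; [exact: ltW|rewrite zE distrC near_l].
by have := ler_distD y z w; lra.
Qed.

HB.instance Definition _ := Uniform_isComplete.Build c0_linf c0_linf_complete.

End c0_linf.

(** * Aperiodic renormings by series of seminorms *)

Lemma series_le_lim (R : realType) (u : R^nat) : (forall n, 0 <= u n) ->
  cvgn (series u) -> forall n, series u n <= limn (series u).
Proof.
move=> u0 cu; apply: nondecreasing_cvgn_le => //; apply/nondecreasing_seqP => n.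
by rewrite /series /= big_nat_recr//= lerDl.
Qed.

Section series_norm.
Context {R : realType} {X : normedModType R} (p : nat -> X -> R) (C : R).
Hypothesis hp : forall i, is_seminorm (p i).
Hypothesis pC : forall i x, p i x <= C * `|x|.

Definition weighted (x : X) : R^nat := fun i => 2^-1 ^+ i * p i x.
Definition series_norm (x : X) : R := `|x| + limn (series (weighted x)).

Let half_ge0 i : 0 <= 2^-1 ^+ i :> R.
Proof. by rewrite exprn_ge0// invr_ge0. Qed.

Let weighted_ge0 x i : 0 <= weighted x i.
Proof. by rewrite mulr_ge0// seminorm_ge0. Qed.

Let weighted_le x i : weighted x i <= geometric (C * `|x|) 2^-1 i.
Proof. by rewrite /weighted /= mulrC ler_wpM2r. Qed.

Let norm_half : `|2^-1 : R| < 1.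
Proof. by rewrite ger0_norm ?invr_ge0// invf_lt1// ltr1n. Qed.

Lemma cvg_weighted x : cvgn (series (weighted x)).
Proof.
apply: (@series_le_cvg R _ (geometric (C * `|x|) 2^-1)) => // [n|].
  exact: le_trans (weighted_ge0 x n) (weighted_le x n).
exact: is_cvg_geometric_series.
Qed.

Lemma lim_weighted_ge0 x : 0 <= limn (series (weighted x)).
Proof.
have := series_le_lim (weighted_ge0 x) (@cvg_weighted x) 0%N.
by rewrite /series /= big_geq.
Qed.

Lemma series_normD x y : series_norm (x + y) <= series_norm x + series_norm y.
Proof.
rewrite /series_norm addrACA lerD ?ler_normD//.
rewrite -lim_seriesD; [|exact: cvg_weighted..].
apply: lim_series_le => [||n]; first exact: cvg_weighted.
  by apply: is_cvg_seriesD; exact: cvg_weighted.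
by rewrite -[leRHS]mulrDr ler_wpM2l// (hp n).1.
Qed.

Lemma series_normZ a x : series_norm (a *: x) = `|a| * series_norm x.
Proof.
rewrite /series_norm normrZ mulrDr; congr (_ + _).
rewrite -[RHS](lim_seriesZ _ (@cvg_weighted x)); congr (limn (series _)).
by apply/funext => i; rewrite /weighted (hp i).2 mulrCA.
Qed.

Lemma le_series_norm x : 1 * `|x| <= series_norm x.
Proof. by rewrite mul1r lerDl lim_weighted_ge0. Qed.

Lemma series_norm_le x : series_norm x <= (1 + 2 * `|C|) * `|x|.
Proof.
rewrite mulrDl mul1r lerD2l.
have cg := @is_cvg_geometric_series R (C * `|x|) _ norm_half.
apply: le_trans (lim_series_le (@cvg_weighted x) cg (weighted_le x)) _.
rewrite (cvg_lim (@Rhausdorff R) (@cvg_geometric_series R (C * `|x|) _ norm_half)).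
have -> : 1 - 2^-1 = 2^-1 :> R by lra.
rewrite invrK.
by rewrite mulrAC ler_wpM2r// mulrC ler_pM2l// ler_norm.
Qed.

Lemma series_norm_eq0 x : series_norm x = 0 -> x = 0.
Proof.
move=> x0; apply/normr0_eq0/eqP; rewrite eq_le normr_ge0 andbT.
by rewrite -x0 -[leLHS]mul1r le_series_norm.
Qed.

Lemma series_norm_equiv : exists m M : R, [/\ 0 < m, 0 < M &
  forall x, m * `|x| <= series_norm x <= M * `|x|].
Proof.
exists 1, (1 + 2 * `|C|); split => // x.
by rewrite le_series_norm series_norm_le.
Qed.

Definition series_renorming : equivalent_norm X :=
  EquivalentNorm series_normD series_normZ series_norm_eq0 series_norm_equiv.

(** The defects of subadditivity of the terms are nonnegative and, together with
    that of the norm of X, they sum to 0. *)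
Lemma series_norm_additive x y :
  series_norm (x + y) = series_norm x + series_norm y ->
  forall i, p i (x + y) = p i x + p i y.
Proof.
move=> xy i; pose defect := weighted x + weighted y - weighted (x + y).
have defect_ge0 n : 0 <= defect n.
  by rewrite subr_ge0 -[leRHS]mulrDr ler_wpM2l// (hp n).1.
have cdefect : cvgn (series defect).
  by apply: is_cvg_seriesB; [apply: is_cvg_seriesD|]; exact: cvg_weighted.
have lim_defect : limn (series defect) <= 0.
  rewrite lim_seriesB; [|apply: is_cvg_seriesD|]; try exact: cvg_weighted.
  rewrite lim_seriesD; try exact: cvg_weighted.
  by move: xy; rewrite /series_norm; have := ler_normD x y; lra.
have := series_le_lim defect_ge0 cdefect i.+1.
rewrite /series /= big_nat_recr//= => le_lim.
have : defect i <= 0.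
  apply: le_trans lim_defect; apply: le_trans le_lim.
  by rewrite lerDr sumr_ge0.
rewrite /defect /weighted; have -> : (weighted x + weighted y - weighted (x + y)) i =
  2^-1 ^+ i * (p i x + p i y - p i (x + y)) by rewrite mulrBr mulrDr.
have := (hp i).1 x y; rewrite pmulr_rle0 ?exprn_gt0 ?invr_gt0//; lra.
Qed.

(** Additivity on z, z + d spreads to the cone spanned by these vectors, so it is
    enough to refute it on z, z + t d for a t as small as desired. *)
Lemma series_renorming_aperiodic :
  (forall d : X, d != 0 -> forall (z0 : X) (e : R), 0 < e ->
     exists2 z : X, `|z - z0| < e & exists i t, [/\ 0 <= t, t <= 1 &
       p i (z + (z + t *: d)) != p i z + p i (z + t *: d)]) ->
  aperiodic (renormed series_renorming).
Proof.
move=> H d d0 z0 e e0; apply: contrapT => K.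
have per (x : renormed series_renorming) : `|x - z0| < e -> `|x + d| = `|x|.
  by move=> xe; apply: contrapT => /eqP ne; apply: K; exists x.
pose M := 1 + 2 * `|C|; have M0 : 0 < M by rewrite /M; have := normr_ge0 C; lra.
have [z ze [i [t [t0 t1]]]] := H d d0 z0 (e / M) (divr_gt0 e0 M0).
have zr : series_norm ((z : X) - z0) < e.
  by apply: le_lt_trans (series_norm_le _) _; rewrite mulrC -ltr_pdivlMr.
have add : series_norm ((z : X) + (z + d)) = series_norm z + series_norm ((z : X) + d).
  exact: (@periodic_additive _ _ d z0 e per z zr).
have cone a b := additive_cone (hp i) (a := a) (b := b) (series_norm_additive add i).
case/eqP.
have -> : z + t *: (d : X) = (1 - t) *: z + t *: (z + d).
  by rewrite scalerDr addrA -scalerDl subrK scale1r.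
have -> : z + ((1 - t) *: z + t *: (z + d)) = (1 + (1 - t)) *: z + t *: (z + d).
  by rewrite addrA [in RHS]scalerDl scale1r.
by rewrite !cone//; lra.
Qed.

End series_norm.

(** * An aperiodic norm on the sum of c_0(R) and l_oo(R) *)

Section euclid.
Context {R : realType}.

Definition euclid (a b : R) : R := Num.sqrt (a ^+ 2 + b ^+ 2).

Lemma euclid_ge0 a b : 0 <= euclid a b. Proof. exact: sqrtr_ge0. Qed.

Lemma euclid_sqr a b : euclid a b ^+ 2 = a ^+ 2 + b ^+ 2.
Proof. by rewrite sqr_sqrtr// addr_ge0// sqr_ge0. Qed.

Lemma euclid_ge a b : `|a| <= euclid a b.
Proof. by rewrite -sqrtr_sqr ler_wsqrtr// lerDl sqr_ge0. Qed.

Lemma euclid_le a b : euclid a b <= `|a| + `|b|.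
Proof.
rewrite -(@ler_pXn2r R 2)// ?nnegrE ?euclid_ge0 ?addr_ge0//.
rewrite euclid_sqr -(real_normK (num_real a)) -(real_normK (num_real b)).
by have := normr_ge0 a; have := normr_ge0 b; nra.
Qed.

Lemma euclidZ c a b : euclid (c * a) (c * b) = `|c| * euclid a b.
Proof.
rewrite /euclid !exprMn -mulrDr sqrtrM ?sqr_ge0//.
by rewrite sqrtr_sqr.
Qed.

(** Cauchy's inequality, in the form of the identity of Lagrange for (a d - b c)^2. *)
Lemma euclidD a b c d : euclid (a + c) (b + d) <= euclid a b + euclid c d.
Proof.
rewrite -(@ler_pXn2r R 2)// ?nnegrE ?addr_ge0 ?euclid_ge0//.
rewrite sqrrD !euclid_sqr.
have : a * c + b * d <= euclid a b * euclid c d.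
  rewrite leNgt; apply/negP => h.
  have := euclid_sqr a b; have := euclid_sqr c d.
  have := euclid_ge0 a b; have := euclid_ge0 c d.
  set s := euclid a b in h *; set t := euclid c d in h * => t0 s0 tE sE.
  have : (s * t) ^+ 2 < (a * c + b * d) ^+ 2.
    by rewrite ltr_pXn2r// nnegrE ?mulr_ge0//; apply: le_trans (ltW h); rewrite mulr_ge0.
  rewrite exprMn sE tE => h2; have h3 := sqr_ge0 (a * d - b * c).
  suff : (1 : R) < 1 by rewrite ltxx.
  lra.
lra.
Qed.

(** Strict convexity of the Euclidean plane: equality in Cauchy's inequality. *)
Lemma euclid_additive a b c d :
  euclid (a + c) (b + d) = euclid a b + euclid c d -> a * d = b * c.
Proof.
move=> h; have := congr1 (fun u => u ^+ 2) h; rewrite sqrrD !euclid_sqr => h2.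
have : (euclid a b * euclid c d) ^+ 2 = (a * c + b * d) ^+ 2.
  congr (_ ^+ 2); lra.
rewrite exprMn !euclid_sqr => h3; apply/eqP; rewrite -subr_eq0 -sqrf_eq0.
by apply/eqP; lra.
Qed.

End euclid.

Section example.
Context {R : realType}.

Definition left_half : set (R + R) := range inl.
Local Notation X := (@c0_linf R _ left_half).

Definition window (q : R) (k : R) : set R := [set g | `|g - q| < k].

(** The same k bounds the length of the window and damps the right half: windows
    around a given point then both avoid a given finite set and make the right
    half negligible. *)
Definition window_seminorm (q k : R) (z : X) : R :=
  sup_over (window q k) (fun g => euclid (z (inl g)) (k * z (inr g))).

Lemma euclid_le_norm (k : R) (z : X) g : 0 <= k -> k <= 1 ->
  euclid (z (inl g)) (k * z (inr g)) <= 2 * `|z|.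
Proof.
move=> k0 k1; apply: le_trans (euclid_le _ _) _.
have := c0_linf_le_norm z (inl g); have := c0_linf_le_norm z (inr g).
rewrite normrM ger0_norm//; change (c0_linf_norm z) with `|z|.
have := normr_ge0 (z (inr g)); nra.
Qed.

Lemma window_seminorm_is_seminorm q k : 0 <= k -> k <= 1 ->
  is_seminorm (window_seminorm q k).
Proof.
move=> k0 k1; apply: (@sup_over_seminorm _ _ _
  (fun g (z : X) => euclid (z (inl g)) (k * z (inr g))) (fun z => 2 * `|z|)).
- move=> g; split => [x y|a x]; first by rewrite !c0_linfD mulrDr; exact: euclidD.
  by rewrite !c0_linfZ mulrCA euclidZ.
- by move=> g z _; exact: euclid_le_norm.
Qed.

Definition window_code (i : nat) : rat * nat := odflt (0, 0%N) (unpickle i).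

Definition window_family (i : nat) : X -> R :=
  window_seminorm (ratr (window_code i).1) (window_code i).2.+1%:R^-1.

Lemma inv_succ_ge0 n : 0 <= n.+1%:R^-1 :> R. Proof. by rewrite invr_ge0. Qed.
Lemma inv_succ_le1 n : n.+1%:R^-1 <= 1 :> R.
Proof. by rewrite invf_le1// ler1n. Qed.

Lemma window_family_seminorm i : is_seminorm (window_family i).
Proof. exact: window_seminorm_is_seminorm (inv_succ_ge0 _) (inv_succ_le1 _). Qed.

Lemma window_family_le i z : window_family i z <= 2 * `|z|.
Proof.
apply: sup_over_le => [|g _]; first by rewrite mulr_ge0.
exact: euclid_le_norm (inv_succ_ge0 _) (inv_succ_le1 _).
Qed.

Lemma exists_near_neq (v w eta : R) : 0 < eta ->
  exists2 s, s != w & `|s - v| <= eta.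
Proof.
move=> e0; have [vw|] := eqVneq v w; last by exists v => //; rewrite subrr normr0 ltW.
exists (v + eta); last by rewrite addrC addKr gtr0_norm.
by rewrite -vw -subr_eq0 addrC addKr gt_eqF.
Qed.

Lemma finite_set_gap (F : set R) (g0 : R) : finite_set F -> ~ F g0 ->
  exists2 rho : R, 0 < rho & forall g, F g -> rho <= `|g - g0|.
Proof.
move=> /finite_seqP[s ->] /= g0s; elim: s g0s => [|g s IH].
  by exists 1 => // g; rewrite in_nil.
move=> /negP; rewrite inE negb_or => /andP[gg0 /negP g0s].
have [rho rho0 rhos] := IH g0s.
exists (Num.min rho `|g - g0|).
  by rewrite lt_min rho0 normr_gt0 subr_eq0 eq_sym.
move=> h /=; rewrite inE ge_min => /predU1P[->|/rhos ->//]; by rewrite lexx orbT.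
Qed.

(** Values below eta on the left half are cut to 0; what remains is a finite set
    because the left half vanishes at infinity. *)
Lemma exists_spread_perturbation (z0 : X) (g0 s r eta : R) : 0 < eta ->
  `|s - z0 (inl g0)| <= eta -> `|r - z0 (inr g0)| <= eta ->
  exists z : X, [/\ `|z - z0| <= eta, z (inl g0) = s, z (inr g0) = r &
    finite_set [set g | g <> g0 /\ z (inl g) != 0]].
Proof.
move=> eta0 sz rz.
pose f (t : R + R) : R := match t with
  | inl g => if g == g0 then s else if eta <= `|z0 (inl g)| then z0 (inl g) else 0
  | inr g => if g == g0 then r else z0 (inr g) end.
have fz t : `|f t - z0 t| <= eta.
  case: t => g /=; case: eqP => [->//|_]; last by rewrite subrr normr0 ltW.
  case: (leP eta) => [_|/ltW]; first by rewrite subrr normr0 ltW.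
  by rewrite sub0r normrN.
have [[M zM] zS] := c0_linfP z0.
have fin : finite_set [set g | eta <= `|z0 (inl g)|].
  have -> : [set g | eta <= `|z0 (inl g)|] =
      inl @^-1` [set t | left_half t /\ eta <= `|z0 t|].
    by apply/seteqP; split => [g gz|g []//]; split => //; exists g.
  by apply: finite_preimage (zS eta eta0) => a b _ _ [].
have ffin : finite_set [set g | g <> g0 /\ f (inl g) != 0].
  apply: sub_finite_set fin => g /= [/eqP /negbTE ->].
  by case: leP => //; rewrite eqxx.
have [|e e0|z zE] := @c0_linf_exists R _ left_half f.
- exists (M + eta) => t; have := fz t; have := zM t.
  have := ler_distD (z0 t) (f t) 0; rewrite !subr0; lra.
- apply: (@sub_finite_set _ _ (inl @` (g0 |` [set g | g <> g0 /\ f (inl g) != 0]))).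
    move=> _ [[g _ <-] eg]; exists g => //.
    have [->|/eqP gg0] := eqVneq g g0; [by left|right].
    by split => //; rewrite -normr_gt0 (lt_le_trans e0).
  by apply: finite_image; rewrite finite_setU; split.
exists z; split.
- by apply: c0_linf_dist_le => [|t]; [exact: ltW|rewrite zE fz].
- by rewrite zE /= eqxx.
- by rewrite zE /= eqxx.
- by apply: sub_finite_set ffin => g /=; rewrite zE.
Qed.

Lemma window_seminorm_peak q k (w : X) g0 : window q k g0 ->
  (forall g, window q k g -> g != g0 ->
     `|w (inl g)| + `|k * w (inr g)| <= `|w (inl g0)|) ->
  window_seminorm q k w = euclid (w (inl g0)) (k * w (inr g0)).
Proof.
move=> wg0 peak.
apply: (@sup_over_max _ _ _ (fun g => euclid (w (inl g)) (k * w (inr g)))) => // g wg.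
have [->//|gg0] := eqVneq g g0.
apply: le_trans (euclid_le _ _) _; apply: le_trans (euclid_ge _ _).
exact: peak.
Qed.

(** The window contains g0 and its length is at most the distance from g0 to F. *)
Lemma exists_window (F : set R) (g0 delta : R) : finite_set F -> ~ F g0 ->
  0 < delta -> exists i, [/\ (window_code i).2.+1%:R^-1 <= delta,
    window (ratr (window_code i).1) (window_code i).2.+1%:R^-1 g0 &
    forall g, window (ratr (window_code i).1) (window_code i).2.+1%:R^-1 g -> ~ F g].
Proof.
move=> finF Fg0 delta0; have [rho rho0 gap] := finite_set_gap finF Fg0.
pose m := Num.min delta (rho / 2).
have m0 : 0 < m by rewrite lt_min delta0 divr_gt0.
pose n := Num.truncn m^-1; pose k : R := n.+1%:R^-1.
have k0 : 0 < k by rewrite invr_gt0.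
have km : k <= m.
  rewrite -[m]invrK lef_pV2 ?posrE ?invr_gt0//.
  exact: ltW (truncnS_gt _).
have [q] : exists q : rat, ratr q \in `](g0 - k), (g0 + k)[.
  by apply: rat_in_itvoo; lra.
rewrite in_itv /= => /andP[q1 q2].
have wg0 : `|g0 - ratr q| < k by rewrite ltr_norml; apply/andP; split; lra.
exists (pickle (q, n)); rewrite /window_code pickleK /=; split => //.
  by rewrite (le_trans km)// ge_min lexx.
move=> g; rewrite /window /= -/k => wg /gap h3.
have h1 := ler_distD (ratr q) g g0; rewrite (distrC (ratr q)) in h1.
have h2 : m <= rho / 2 by rewrite ge_min lexx orbT.
suff : (1 : R) < 1 by rewrite ltxx.
lra.
Qed.

(** z is chosen nonzero on the left and not parallel to d at g0; a short window
    around g0 then sees only the values at g0 of z and of its small perturbations,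
    and the Euclidean plane is strictly convex. *)
Lemma window_family_not_additive (d : X) : d != 0 -> forall (z0 : X) (e : R),
  0 < e -> exists2 z : X, `|z - z0| < e & exists i t, [/\ 0 <= t, t <= 1 &
    window_family i (z + (z + t *: d)) !=
    window_family i z + window_family i (z + t *: d)].
Proof.
move=> d0 z0 e e0.
have [g0 dg0] : exists g, (d (inl g) != 0) || (d (inr g) != 0).
  apply: contrapT => /forallNP H; move/eqP: d0; apply; apply: c0_linf_eq.
  by case=> g; have /negP := H g; rewrite negb_or !negbK => /andP[/eqP h1 /eqP h2].
have eta0 : 0 < e / 2 by lra.
have [s s0 sz] := exists_near_neq (z0 (inl g0)) 0 eta0.
have [r rs rz] := exists_near_neq (z0 (inr g0)) (s * d (inr g0) / d (inl g0)) eta0.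
have det : s * d (inr g0) != r * d (inl g0).
  have [d1|d1] := eqVneq (d (inl g0)) 0.
    by move: dg0; rewrite d1 eqxx mulr0 mulf_eq0 negb_or s0.
  by apply: contra_neq rs => ->; rewrite mulfK.
have [z [zz0 zs zr zfin]] := exists_spread_perturbation eta0 sz rz.
exists z; first by lra.
pose B := `|z| + `|d| + 1.
have B1 : 1 <= B by rewrite /B; have := normr_ge0 z; have := normr_ge0 d; lra.
have ns : 0 < `|s| by rewrite normr_gt0.
(* 8 B leaves room for the contributions of t d and of the right half to 2 z + t d,
   at g0 and away from g0. *)
pose delta := Num.min 1 (`|s| / (8 * B)).
have delta0 : 0 < delta by rewrite lt_min ltr01 divr_gt0//; lra.
have deltas : delta * (8 * B) <= `|s|.
  by rewrite -ler_pdivlMr ?ge_min ?lexx ?orbT//; lra.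
have delta1 : delta <= 1 by rewrite ge_min lexx.
have zfin0 : ~ [set g | g <> g0 /\ z (inl g) != 0] g0 by case.
have [i [ki wi Fi]] := exists_window zfin zfin0 delta0.
set q : R := ratr _ in wi Fi; set k : R := _^-1 in ki wi Fi.
have k0 : 0 < k by rewrite invr_gt0.
exists i, delta; split => //; first exact: ltW.
have zB t : `|z t| <= B.
  have := c0_linf_le_norm z t; change (c0_linf_norm z) with `|z|.
  by rewrite /B; have := normr_ge0 d; lra.
have dB t : `|d t| <= B.
  have := c0_linf_le_norm d t; change (c0_linf_norm d) with `|d|.
  by rewrite /B; have := normr_ge0 z; lra.
have z_off g : window q k g -> g != g0 -> z (inl g) = 0.
  by move=> /Fi wg /eqP gg0; apply: contrapT => /eqP zg; apply: wg.
(* The three vectors z, z + t d and 2 z + t d are all of the form a z + b d. *)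
have peak (a b : R) (w : X) : (forall t, w t = a * z t + b * d t) ->
    1 <= a -> a <= 2 -> 0 <= b -> b <= delta ->
    window_seminorm q k w = euclid (w (inl g0)) (k * w (inr g0)).
  move=> wE a1 a2 b0 bd; apply: window_seminorm_peak => // g wg gg0.
  rewrite !wE z_off// mulr0 add0r zs.
  have h1 : `|b * d (inl g)| <= delta * B.
    by rewrite normrM ler_pM// ger0_norm.
  have h2 : `|k * (a * z (inr g) + b * d (inr g))| <= delta * (3 * B).
    rewrite normrM (gtr0_norm k0) ler_pM// ?(ltW k0)//.
    apply: le_trans (ler_normD _ _) _.
    rewrite !normrM (ger0_norm b0) (ger0_norm (le_trans ler01 a1)).
    have := zB (inr g); have := dB (inr g).
    have := normr_ge0 (z (inr g)); have := normr_ge0 (d (inr g)); nra.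
  have h3 : `|b * d (inl g0)| <= delta * B.
    by rewrite normrM ler_pM// ger0_norm.
  have h4 : `|s| <= `|a * s|.
    by rewrite normrM ger0_norm ?ler_peMl//; lra.
  have := ler_normD (a * s + b * d (inl g0)) (- (b * d (inl g0))).
  rewrite addrK normrN; lra.
change (window_family i) with (window_seminorm q k).
have b0 : 0 <= delta by exact: ltW.
rewrite (peak 1 0 z)//; last 2 first.
- by move=> t; rewrite mul1r mul0r addr0.
- by rewrite ler1n.
rewrite (peak 1 delta (z + delta *: d)) //; last 2 first.
- by move=> t; rewrite c0_linfD c0_linfZ mul1r.
- by rewrite ler1n.
rewrite (peak 2 delta (z + (z + delta *: d)))//; last 2 first.
- by move=> t; rewrite !c0_linfD c0_linfZ addrA mulrDl mul1r.
- by rewrite ler1n.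
rewrite !c0_linfD !c0_linfZ zs zr mulrDr.
apply/eqP => /euclid_additive E; case/eqP: det.
have kd : k * delta != 0 by rewrite mulf_neq0// gt_eqF.
apply: (mulfI kd); lra.
Qed.

End example.

(** * Day's theorem on l_oo of an uncountable set *)

Lemma countable_setU (T : Type) (A B : set T) :
  countable A -> countable B -> countable (A `|` B).
Proof.
move=> cA cB; rewrite -bigcup2E; apply: bigcup_countable => // -[|[|n]] _ //=.
Qed.

Section day.
Context {R : realType} {T : Type} {S : set T} (N : equivalent_norm (@c0_linf R T S)).
Hypothesis uncS : ~ countable (~` S).
Local Notation X := (@c0_linf R T S).
Local Notation M := (eqv_norm N).

Definition support (z : X) : set T := [set t | z t != 0].

(** Countability of the support leaves, for any pattern, a point of the complement
    of S which is free. *)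
Definition pattern (z : X) : Prop := [/\ countable (support z),
  forall t, `|z t| <= 1 & forall t, S t -> z t = 0].

Definition extends (w z : X) : Prop := forall t, z t != 0 -> w t = z t.

Lemma extends_trans (y x z : X) : extends x y -> extends y z -> extends x z.
Proof. by move=> xy yz t zt; rewrite xy yz. Qed.

Lemma exists_pattern (f : T -> R) : countable [set t | f t != 0] ->
  (forall t, `|f t| <= 1) -> (forall t, S t -> f t = 0) ->
  exists2 z : X, pattern z & forall t, z t = f t.
Proof.
move=> fc f1 fS; have [||z zE] := @c0_linf_exists R T S f; first by exists 1.
  move=> e e0; rewrite [X in finite_set X](_ : _ = set0)//.
  by apply/seteqP; split => // t [/fS ->]; rewrite normr0 leNgt e0.
exists z => //; split; last 2 first.
- by move=> t; rewrite zE.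
- by move=> t; rewrite zE; exact: fS.
by rewrite /support; under eq_fun do rewrite zE.
Qed.

Lemma pattern0 : pattern 0.
Proof.
split => [|t|//]; last by rewrite c0_linf0 normr0.
rewrite [support _](_ : _ = set0)//; apply/seteqP; split => // t.
by rewrite /support /= c0_linf0 eqxx.
Qed.

Lemma exists_almost_maximal_extension (z : X) (delta : R) : pattern z -> 0 < delta ->
  exists g : X, [/\ pattern g, extends g z &
    forall h, pattern h -> extends h z -> M h <= M g + delta].
Proof.
move=> zP d0; have [m [B [m0 B0 mB]]] := eqv_norm_equiv N.
pose E := [set M h | h in [set h : X | pattern h /\ extends h z]].
have Eub : ubound E B.
  move=> _ [h [[_ h1 _] _] <-]; have /andP[_] := mB h.
  move=> /le_trans; apply; rewrite -[leRHS]mulr1 ler_pM2l//.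
  exact: c0_linf_norm_le.
have Esup : has_sup E by split; [exists (M z); exists z|exists B].
have [_ [g [gP gz] <-] gE] := sup_adherent d0 Esup.
exists g; split => // h hP hz; rewrite -lerBlDr (le_trans _ (ltW gE))//.
by rewrite lerB//; apply: ub_le_sup; [exists B|exists h].
Qed.

(** Let f (n + 1) maximise M among the extensions of f n, up to 1 / (n + 1).  If h
    extends f (n + 1), so does its reflection 2 f (n + 1) - h, and the average of
    the two is f (n + 1); neither can exceed M (f (n + 1)) by more than
    1 / (n + 1), so neither can be smaller by more than that.  Hence M is constant on
    the common extensions of all the f n. *)
Lemma exists_rigid_pattern : exists2 f : X, pattern f &
  forall h, pattern h -> extends h f -> M h = M f.
Proof.
pose P := {z : X | pattern z}.
have /choice[step stepP] : forall nz : nat * P, exists g : P,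
    extends (sval g) (sval nz.2) /\
    forall h, pattern h -> extends h (sval nz.2) ->
      M h <= M (sval g) + nz.1.+1%:R^-1.
  move=> [n [z zP]] /=.
  have [//||g [gP gz gmax]] := @exists_almost_maximal_extension z n.+1%:R^-1.
    by rewrite invr_gt0.
  by exists (exist _ g gP).
pose fs := fix fs n : P :=
  if n is n'.+1 then step (n', fs n') else exist _ 0 pattern0.
pose f n : X := sval (fs n).
have fP n : pattern (f n) by exact: svalP.
have fS n : extends (f n.+1) (f n) by exact: (stepP (n, fs n)).1.
have fmax n h : pattern h -> extends h (f n) -> M h <= M (f n.+1) + n.+1%:R^-1.
  exact: (stepP (n, fs n)).2.
have fmono m n : (m <= n)%N -> extends (f n) (f m).
  elim: n => [|n IH]; first by rewrite leqn0 => /eqP ->.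
  rewrite leq_eqVlt => /predU1P[->//|]; rewrite ltnS => /IH.
  exact: extends_trans.
have fagree m n t : f m t != 0 -> f n t != 0 -> f m t = f n t.
  move=> fm fn; have [/fmono ->//|/ltnW/fmono] := leqP m n.
  by move=> ->.
pose l t : R :=
  if pselect (exists n, f n t != 0) is left e then f (projT1 (cid e)) t else 0.
have lE n t : f n t != 0 -> l t = f n t.
  move=> fn; rewrite /l; case: pselect => [e|[]]; last by exists n.
  by apply: fagree => //; exact: (projT2 (cid e)).
have l0 t : l t != 0 -> exists n, f n t != 0.
  by rewrite /l; case: pselect => // _; rewrite eqxx.
have [|t|t St|F FP FE] := @exists_pattern l.
- have -> : [set t | l t != 0] = \bigcup_n (support (f n)).
    apply/seteqP; split => [t /l0[n fn]|t [n _ fn]]; first by exists n.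
    by rewrite /= (lE n).
  by apply: bigcup_countable => // n _; have [] := fP n.
- have [->|/l0[n fn]] := eqVneq (l t) 0; first by rewrite normr0.
  by rewrite (lE n)//; have [_ ->] := fP n.
- apply/eqP; apply: contrapT => /negP /l0[n].
  by have [_ _ ->//] := fP n; rewrite eqxx.
have Ff n : extends F (f n) by move=> t fn; rewrite FE (lE n).
have close n h : pattern h -> extends h (f n.+1) ->
    `|M h - M (f n.+1)| <= n.+1%:R^-1.
  move=> hP hf; pose g := f n.+1; pose h' : X := 2 *: g - h.
  have h'E t : h' t = 2 * g t - h t by [].
  have h'g : extends h' g by move=> t gt; rewrite h'E hf//; lra.
  have h'P : pattern h'.
    have [gc g1 gS] := fP n.+1; have [hc h1 hS] := hP.
    split.
    - apply: (@sub_countable _ _ _ (support g `|` support h)).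
        apply: subset_card_le => t; rewrite /support /= => h't.
        have [gt|gt] := eqVneq (g t) 0; [right|by left].
        by apply: contraNneq h't => ht; rewrite h'E gt ht mulr0 subrr.
      exact: countable_setU.
    - move=> t; rewrite h'E; have [gt|gt] := eqVneq (g t) 0.
        by rewrite gt mulr0 sub0r normrN.
      by rewrite (hf t gt) -/g mulr2n mulrDl mul1r addrK.
    - by move=> t St; rewrite h'E gS// hS// mulr0 subrr.
  have Mh := fmax n h hP (extends_trans hf (fS n)).
  have Mh' := fmax n h' h'P (extends_trans h'g (fS n)).
  have h2 : 2 * M g <= M h' + M h.
    have : M (2 *: g) <= M h' + M h by rewrite -[2 *: g](subrK h) eqv_normD.
    by rewrite eqv_normZ ger0_norm.
  rewrite -/g in Mh Mh' *.
  move: Mh Mh'; set dl := _^-1 => Mh Mh'.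
  by rewrite ler_norml; apply/andP; split; lra.
exists F => // h hP hF; apply/eqP; rewrite -subr_eq0 -normr_le0.
apply/ler_addgt0Pr => e e0; rewrite add0r.
pose n := Num.truncn (2 / e).
have ne : n.+1%:R^-1 <= e / 2.
  rewrite -[e / 2]invrK lef_pV2 ?posrE ?invr_gt0 ?divr_gt0// invf_div.
  exact: ltW (truncnS_gt _).
have c1 := close n h hP (extends_trans hF (Ff n.+1)).
have c2 := close n F FP (Ff n.+1).
have := ler_distD (M (f n.+1)) (M h) (M F).
rewrite (distrC (M (f n.+1))).
by move: ne c1 c2; set dl := _^-1 => *; lra.
Qed.

(** A rigid pattern f vanishes at some t0 outside S.  Changing its value there to
    1 and to -1 does not change M and gives two vectors of mean f. *)
Lemma not_strictly_convex_renorming : ~ strictly_convex (renormed N).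
Proof.
move=> /strictly_convexP sc; have [f [fc f1 fS] frigid] := exists_rigid_pattern.
have [t0 [St0 ft0]] : exists t0, ~ S t0 /\ f t0 = 0.
  apply: contrapT => /forallNP H; apply: uncS.
  apply: sub_countable fc; apply: subset_card_le => t St.
  by apply/negP => /eqP ft; apply: (H t).
have bump (c : R) : `|c| <= 1 ->
    exists2 h : X, M h = M f & h t0 = c /\ forall t, t <> t0 -> h t = f t.
  move=> c1; pose F t : R := if pselect (t = t0) then c else f t.
  have F0 : F t0 = c by rewrite /F; case: pselect.
  have Fn t : t <> t0 -> F t = f t by rewrite /F; case: pselect.
  have [|t|t St|h hP hE] := @exists_pattern F.
  - apply: (@sub_countable _ _ _ (support f `|` [set t0])).
      apply: subset_card_le => t /=; have [->|tt0] := pselect (t = t0); first by right.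
      by rewrite Fn//; left.
    by apply: countable_setU => //; exact: finite_set_countable.
  - by have [->|tt0] := pselect (t = t0); [rewrite F0|rewrite Fn].
  - by rewrite Fn ?fS// => tt0; apply: St0; rewrite -tt0.
  exists h; last by rewrite hE F0; split => // t tt0; rewrite hE Fn.
  apply: frigid => // t ft; rewrite hE Fn// => tt0.
  by move: ft; rewrite tt0 ft0 eqxx.
have [|u Mu [u0 un]] := bump 1; first by rewrite normr1.
have [|v Mv [v0 vn]] := bump (-1); first by rewrite normrN1.
have uv : u + v = 2 *: f.
  apply: c0_linf_eq => t; rewrite c0_linfD c0_linfZ.
  have [->|tt0] := pselect (t = t0); first by rewrite u0 v0 ft0 subrr mulr0.
  by rewrite un// vn//; lra.
have add : M (u + v) = M u + M v.
  by rewrite uv (eqv_normZ N) ger0_norm// Mu Mv; lra.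
have : M v *: u = M u *: v := sc u v add.
have Mf : M f != 0.
  rewrite -Mu; apply/eqP => /(eqv_norm_eq0 (e := N)) u00.
  by move: u0; rewrite u00 c0_linf0 => /eqP; rewrite eq_sym oner_eq0.
rewrite Mu Mv => /(scalerI Mf) uvE; move: u0; rewrite uvE v0; lra.
Qed.

End day.

(** * The theorem *)

Lemma uncountable_left_half (R : realType) : ~ countable [set: R] ->
  ~ countable (~` (@left_half R)).
Proof.
move=> uncR; apply: contra_not uncR => c.
apply: sub_countable c.
have inrT : (range (@inr R R) #= [set: R])%card by apply: inj_card_eq => x y _ _ [].
by rewrite -(card_le_eql inrT); apply: subset_card_le => _ [x _ <-] [y _].
Qed.

Lemma renormed_counterexample (R : realType) (X : completeNormedModType R)
    (N : equivalent_norm X) : aperiodic (renormed N) ->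
  (forall M : equivalent_norm X, ~ strictly_convex (renormed M)) ->
  exists Y : completeNormedModType R, property_S Y /\
    ~ exists M : equivalent_norm Y, strictly_convex (renormed M).
Proof.
move=> aper nsc; exists (renormed N); split; first exact/property_SP.
by move=> [M scM]; apply: (nsc (eqv_norm_comp M)); apply/strictly_convex_comp.
Qed.

Lemma exists_S_not_strictly_convexifiable (R : realType) : ~ countable [set: R] ->
   exists X : completeNormedModType R,
     property_S X /\
     ~ exists N : equivalent_norm X, strictly_convex (renormed N).
Proof.
move=> uncR.
apply: (@renormed_counterexample R (@c0_linf R _ (@left_half R))
  (series_renorming (@window_family_seminorm R) (@window_family_le R))).
  exact: series_renorming_aperiodic (@window_family_not_additive R).
move=> N; apply: not_strictly_convex_renorming; exact: uncountable_left_half.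
Qed.

Theorem theoremB (R : realType) :
  (@real_valued_measurable R R [set: R] ->
   exists X : completeNormedModType R,
     property_S X /\
     ~ exists N : equivalent_norm X, strictly_convex (renormed N)) /\
  (forall X : completeNormedModType R,
     (dim_le X 2 -> (property_S X <-> strictly_convex X)) /\
     (~ dim_le X 2 ->
      (exists N : equivalent_norm X, property_S (renormed N)) ->
      exists N : equivalent_norm X,
        ~ strictly_convex (renormed N) /\ property_S (renormed N))).
Proof.
split=> [[uncR _]|X]; first exact: exists_S_not_strictly_convexifiable.
split=> [dimX|dimX]; last exact: exists_nonstrictly_convex_renorming.
split=> [/property_SP|/strictly_convex_aperiodic /property_SP//].
exact: aperiodic_strictly_convex.
Qed.
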